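(* Let $d\ge2$ and let $f(z)=\bar z^{\,d}+c$, $c\in\mathbb{C}$, be a unicritical anti-polynomial. Then at most three periodic dynamical rays can land at a periodic point of odd period of $f$.
   Context: Every unicritical anti-polynomial of degree $d\ge2$ is affinely conjugate to some $f_c(z)=\bar z^{\,d}+c$, and is taken in this form. The Julia set $J(f_c)$ is the boundary of the set of points with bounded forward orbit. There is a Böttcher map $\varphi_c$ near $\infty$ (conformal, $\varphi_c(z)/z\to1$) conjugating $f_c$ to $z\mapsto\bar z^{\,d}$. The dynamical ray $\mathcal{R}_t$, $t\in\mathbb{R}/\mathbb{Z}$, is the preimage of the radial line at angle $t$ under $\varphi_c$, extended by pull-back toward $J(f_c)$; $f_c(\mathcal{R}_t)=\mathcal{R}_{-dt}$. It lands at $z\in J(f_c)$ if it is well defined all the way to $J(f_c)$ (it meets neither the critical point $0$ nor an iterated preimage of it) and converges to $z$. A ray $\mathcal{R}_t$ is periodic if $t$ is periodic under $t\mapsto -dt$ on $\mathbb{R}/\mathbb{Z}$. The period of a periodic point is its exact (least) period. *)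

(* Defs.v *)
From HB Require Import structures.
From mathcomp Require Import all_boot all_order all_algebra.
From mathcomp Require Import all_classical all_reals all_analysis.
From mathcomp Require Export complex.
Set Implicit Arguments.
Unset Strict Implicit.
Unset Printing Implicit Defensive.
Import Order.TTheory GRing.Theory Num.Theory.
Import numFieldNormedType.Exports.

Local Open Scope classical_set_scope.
Local Open Scope ring_scope.
Local Open Scope complex_scope.

(* The topology and norm of the complex plane [R[i]], seen as a normed module
   over itself; hence [derivable _ z 1] below is complex differentiability. *)
HB.instance Definition _ (R : rcfType) := NormedModule.copy R[i] R[i]^o.

Definition antipoly (R : realType) (d : nat) (c : R[i]) : R[i] -> R[i] :=
  fun z => z^* ^+ d + c.

Definition filled_julia (R : realType) (f : R[i] -> R[i]) : set R[i] :=
  [set z | bounded_set [set iter n f z | n in [set: nat]]].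

Definition julia (R : realType) (f : R[i] -> R[i]) : set R[i] :=
  closure (filled_julia f) `\` interior (filled_julia f).

Definition has_period (T : Type) (f : T -> T) (p : nat) (z : T) : Prop :=
  [/\ (0 < p)%N, iter p f z = z
    & forall k, (0 < k < p)%N -> iter k f z <> z].

(* Angles are measured in turns. *)
Definition expturn (R : realType) (t : R) : R[i] :=
  cos (2 * pi * t) +i* sin (2 * pi * t).

(* [phi] maps the neighbourhood [U] of infinity conformally onto
   [{|w| > rho}] and conjugates [f] to [w |-> conj(w)^d] there.  The values of
   [phi] outside [U] are irrelevant.  The normalisation [phi(z)/z -> 1] makes
   the germ of [phi] at infinity unique (without it, [phi] would be determined
   only up to a (d+1)-st root of unity). *)
Record bottcher_map (R : realType) (d : nat) (f : R[i] -> R[i])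
    (U : set R[i]) (rho : R) (phi : R[i] -> R[i]) : Prop := BottcherMap {
  bottcher_open : open U ;
  bottcher_nbhs : exists M : R, forall z, M%:C < `|z| -> U z ;
  bottcher_stable : forall z, U z -> U (f z) ;
  bottcher_bij : set_bij U [set w | rho%:C < `|w|] phi ;
  bottcher_holo : forall z, U z -> derivable phi z 1 ;
  bottcher_conj : forall z, U z -> phi (f z) = (phi z)^* ^+ d ;
  bottcher_norm : forall e : R, 0 < e ->
    exists M : R, forall z, M%:C < `|z| -> `|phi z / z - 1| < e%:C }.

(* [gamma r] is the point of the ray of angle [t] at radius [r > 1], i.e. of
   potential [ln r].  For [n = 0] the second clause says that the part of the
   ray near infinity is the preimage of the radial line under [phi]; for
   [n > 0] it says that the ray is continued by pull-back: [f^n] carries the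
   part with [r ^ (d ^ n) > rho] into the part near infinity of the ray of
   angle [(-d)^n t]. *)
Definition dynamical_ray (R : realType) (d : nat) (f : R[i] -> R[i])
    (U : set R[i]) (rho : R) (phi : R[i] -> R[i]) (t : R)
    (gamma : R -> R[i]) : Prop :=
  {in `]1, +oo[, continuous gamma} /\
  forall (n : nat) (r : R), 1 < r -> rho < r ^+ (d ^ n) ->
    U (iter n f (gamma r)) /\
    phi (iter n f (gamma r)) =
      (r ^+ (d ^ n))%:C * expturn ((- d%:R) ^+ n * t).

(* The point 0 is the critical point of [f].  A curve [gamma] as below avoids
   all its iterated preimages, so it is the unique continuation by pull-back
   of the ray from infinity. *)
Definition ray_lands (R : realType) (d : nat) (f : R[i] -> R[i])
    (U : set R[i]) (rho : R) (phi : R[i] -> R[i]) (t : R) (z : R[i]) : Prop :=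
  julia f z /\
  exists gamma : R -> R[i],
    [/\ dynamical_ray d f U rho phi t gamma,
        forall (n : nat) (r : R), 1 < r -> iter n f (gamma r) <> 0
      & gamma r @[r --> 1^'+] --> z].

(* Periodicity of [t] modulo 1 under [t |-> -d t]. *)
Definition periodic_angle (R : realType) (d : nat) (t : R) : Prop :=
  exists2 k : nat, (0 < k)%N & (- d%:R) ^+ k * t - t \is a Num.int.

(* Elements of R/Z are represented in [[0, 1[]. *)
Definition periodic_rays_at (R : realType) (d : nat) (f : R[i] -> R[i])
    (U : set R[i]) (rho : R) (phi : R[i] -> R[i]) (z : R[i]) : set R :=
  [set t | [/\ 0 <= t < 1, periodic_angle d t & ray_lands d f U rho phi t z]].

(* Main.v *)
(* For [0 <= j < p] let [A_j] be the angles of the rays landing at [f^j(z)]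
   (restricted to finitely many), cyclically ordered.  Rays landing at distinct
   points are unlinked: two paths whose ends are linked at infinity meet, by a
   winding number computation.  Applied to [f^j(z)] and its rotation by [1/d]
   turn, which has the same image, this puts [A_j] in an arc of length less than
   [1/d], so that [t |-> -d t] maps [A_j] onto [A_(j+1)] reversing the cyclic
   order.  Hence gaps of [A_j] go to gaps of [A_(j+1)], [d] times longer except
   for the one critical gap, whose image is the critical value gap.  As [p] is
   odd, the first return map on [A_0] is an orientation-reversing bijection of a
   finite cyclically ordered set, i.e. a reflection: each gap has period [p] or
   [2p].  The shortest gap of a cycle of gaps is a critical value gap, and, by
   unlinkedness, critical value gaps are nested or cover the circle.  At the
   point carrying the shortest critical value gap this shows (as in Milnor's
   study of orbit portraits) that a gap outside the cycle of that critical value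
   gap is strictly longer than all the other gaps.  There is thus at most one
   such gap, next to the at most two gaps of a cycle of length at most [2p]. *)

Require Import Defs.
From mathcomp Require Import all_boot all_order all_algebra.
From mathcomp Require Import all_classical all_reals all_analysis.
From mathcomp Require Import zify ring lra.
Import Order.TTheory GRing.Theory Num.Theory.
Import numFieldNormedType.Exports.
Local Open Scope classical_set_scope.
Local Open Scope card_scope.
Local Open Scope ring_scope.
Local Open Scope complex_scope.
Set Implicit Arguments.
Unset Strict Implicit.
Unset Printing Implicit Defensive.

(** * Expansion of the gaps of an orbit portrait *)

(** The restriction to finitely many angles is obtained by contradiction. Four periodic angles have
    a common period [K] under multiplication by [-d]; the angles t in [0, 1) of rays landing at [z]
    for which ((-d)^K - 1) t is an integer form a finite set, stable under the first return, which
    contains the four. The rotation by 1/d turn moves f^j(z) only if f^j(z) is not the critical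
    point 0. A periodic critical point traps a disk around it, while the points of a ray escape, so
    no ray lands on it. Two rays that meet are not at once equal: after a rotation by k/d only their
    images under f agree, and comparing Boettcher coordinates at a late time N says no more than
    that (-d)^N (t - t') is an integer. Periodicity of the angles cancels the factor (-d)^N, and a
    ray is determined by its angle because its continuation by pull-back avoids the critical
    point. *)

Lemma periodic_attains_min (R : realDomainType) (u : nat -> R) (q : nat) :
  (0 < q)%N -> (forall j, u (j + q)%N = u j) -> exists j, forall k, u j <= u k.
Proof.
case: q => // q _ uq.
case: (@arg_minP _ _ _ ord0 xpredT (fun j : 'I_q.+1 => u j)) => // j _ jmin.
exists j => k.
have -> : u k = u (k %% q.+1)%N.
  rewrite {1}(divn_eq k q.+1) addnC.
  by elim: (k %/ q.+1)%N => [|m IH]; rewrite ?addn0// mulSn addnCA addnC uq.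
exact: (jmin (Ordinal (ltn_pmod k (ltn0Sn q)))).
Qed.

Lemma sumD1_le (R : realDomainType) (n : nat) (u : 'I_n -> R) (i k : 'I_n) :
  (forall m, 0 < u m) -> \sum_m u m = 1 -> k != i -> u k <= 1 - u i.
Proof.
move=> u0 <- ki; rewrite (bigD1 i)//= (bigD1 k)//=.
rewrite [leRHS]addrC addKr lerDl; apply: sumr_ge0 => m _; exact: ltW.
Qed.

(* The gaps of the finite set of angles at a periodic point are labelled once
   and for all by [i : 'I_n] and transported by the dynamics: [l j i] is the
   length of gap [i] at the [j]-th point of the orbit and [c j] is the label of
   the gap that contains the critical point there, so that [1 - l j (c j)] is
   the width of the hull of the angles. *)
Section gap_dynamics.
Variables (R : realFieldType) (n : nat) (d : R) (p : nat).
Variables (l : nat -> 'I_n -> R) (c : nat -> 'I_n).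
Hypotheses (d1 : 1 < d) (p0 : (0 < p)%N).
Hypothesis l_gt0 : forall j i, 0 < l j i.
Hypothesis l_sum : forall j, \sum_i l j i = 1.
Hypothesis l_expand : forall j i, i != c j -> l j.+1 i = d * l j i.
Hypothesis l_per : forall j i, l (j + p.*2)%N i = l j i.
Hypothesis l_nest : forall j k, j != k %[mod p] ->
  [\/ exists2 i, i != c j & 1 - l k (c k) < l j i,
      d * ((1 - l j (c j)) + (1 - l k (c k))) < 1
    | exists2 i, i != c k & 1 - l j (c j) < l k i].

Let d0 : 0 < d. Proof. by rewrite (lt_trans _ d1). Qed.

(** All other gaps are multiplied by [d] and the total length stays 1, so the image of the critical
    gap, the critical value gap, is what remains of the circle. *)
Lemma critical_gap_image j : l j.+1 (c j) = 1 - d * (1 - l j (c j)).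
Proof.
have -> : 1 - l j (c j) = \sum_(i | i != c j) l j i.
  by have := l_sum j; rewrite (bigD1 (c j))//= => <-; rewrite addrAC subrr add0r.
rewrite mulr_sumr -(l_sum j.+1) (bigD1 (c j))//=.
by rewrite (eq_bigr (fun i => d * l j i)) ?addrK// => i ic; exact: l_expand.
Qed.

(** Otherwise the label [c j] would be multiplied by [d] at time j + 2p, and comparison with
    [critical_gap_image] would give d = 1. *)
Lemma critical_gap_periodic j : c (j + p.*2)%N = c j.
Proof.
apply/eqP; apply/negPn/negP; rewrite eq_sym => /l_expand.
rewrite -addSn !l_per critical_gap_image => /eqP.
rewrite mulrBr mulr1 opprB addrCA -[X in _ == X]addr0 (inj_eq (addrI _)).
by rewrite subr_eq0 lt_eqF.
Qed.

Lemma critical_gap_mod j k : j = k %[mod p.*2] -> c j = c k.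
Proof.
have cm m : c m = c (m %% p.*2)%N.
  rewrite {1}(divn_eq m p.*2) addnC.
  elim: (m %/ p.*2)%N => [|e IH]; rewrite ?addn0// mulSn addnCA addnC.
  by rewrite critical_gap_periodic.
by move=> jk; rewrite cm jk -cm.
Qed.

(** A gap at its minimal length cannot come from multiplication by d > 1, so it was critical one
    step earlier. *)
Lemma gap_min_critical i : exists j, c j = i /\ forall k, l j.+1 i <= l k i.
Proof.
have p20 : (0 < p.*2)%N by rewrite double_gt0.
have [j jmin] := @periodic_attains_min _ (fun j => l j i) _ p20 (l_per^~ i).
(* Adding a period places the minimum at a positive time, which has a predecessor. *)
have [k kmin] : exists k, forall m, l k.+1 i <= l m i.
  exists (j + p.*2).-1 => m; rewrite prednK ?addn_gt0 ?p20 ?orbT//.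
  by rewrite l_per jmin.
exists k; split=> //; apply/eqP; apply/negPn/negP; rewrite eq_sym => /l_expand E.
have := kmin k; rewrite E leNgt ltr_pMl ?d1//.
Qed.

(* Let [c j1] be the shortest critical value gap.  If a label [a] is critical at
   a time not congruent to [j1], nestedness makes [a] strictly longer than every
   other gap at time [j1 + 1]; at most one label can be the longest, and only
   the two labels [c j1] and [c (j1 + p)] escape the argument. *)
Lemma gap_dynamics_valence : (n <= 3)%N.
Proof.
rewrite leqNgt; apply/negP => n3.
have [j1 j1min] : exists j, forall k, l j.+1 (c j) <= l k.+1 (c k).
  apply: (@periodic_attains_min _ (fun j => l j.+1 (c j)) p.*2).
    by rewrite double_gt0.
  by move=> j; rewrite -addSn l_per critical_gap_periodic.
have gmin j i : l j1.+1 (c j1) <= l j i.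
  by have [k [<- kmin]] := gap_min_critical i; exact: le_trans (j1min k) (kmin j).
have le1 j i k : k != i -> l j k <= 1 - l j i.
  exact: sumD1_le (l_gt0 j) (l_sum j).
have other a : exists b : 'I_n, b != a.
  have [->|] := eqVneq a (Ordinal (leq_trans (isT : (0 < 4)%N) n3)).
    by exists (Ordinal (leq_trans (isT : (1 < 4)%N) n3)).
  by move=> ha; eexists; rewrite eq_sym; exact: ha.
have key a : a != c j1 -> a != c (j1 + p)%N ->
    forall b, b != a -> l j1.+1 b < l j1.+1 a.
  move=> a1 a2; have [j [cj jmin]] := gap_min_critical a.
  have jj1 : j1 != j %[mod p].
    apply/negP => /eqP jj1.
    (* A class modulo p splits into two classes modulo 2p. On them [c] takes the values [c j1] and
       [c (j1 + p)], both excluded for [a]. *)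
    have : (j = j1 %[mod p.*2]) \/ (j = j1 + p %[mod p.*2]).
      move: jj1 p0 => /esym/eqP.
      have [jl|lj] := leqP j j1.
        rewrite eq_sym eqn_mod_dvd// => /dvdnP[m e] _.
        have -> : j1 = (j + m * p)%N by lia.
        rewrite -(odd_double_half m); case: (odd m).
          right; rewrite (_ : (_ + _)%N = (j + (m./2.+1) * p.*2)%N); last by lia.
          by rewrite addnC modnMDl.
        left; rewrite (_ : (_ + _)%N = (j + (m./2) * p.*2)%N); last by lia.
        by rewrite addnC modnMDl.
      rewrite eqn_mod_dvd ?(ltnW lj)// => /dvdnP[m e] _.
      have -> : j = (j1 + m * p)%N by lia.
      rewrite -(odd_double_half m); case: (odd m).
        right; rewrite (_ : (_ + _)%N = (m./2 * p.*2 + (j1 + p))%N); last by lia.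
        by rewrite modnMDl.
      left; rewrite (_ : (_ + _)%N = (m./2 * p.*2 + j1)%N); last by lia.
      by rewrite modnMDl.
    by case=> /critical_gap_mod; rewrite cj => /eqP; apply/negP.
  have cimg := critical_gap_image j; have cimg1 := critical_gap_image j1.
  have [[i ic h]|h|[i ic h]] := l_nest jj1.
  (* At time j1 + 1 the gap [i] exceeds the complement of the critical value gap of time [j], so
     every other gap is shorter than [l j.+1 a], which is the minimal length of [a]. Hence [i] can
     only be [a]. *)
  - have li := l_expand ic.
    have {}h : 1 - l j.+1 a < l j1.+1 i.
      by rewrite -cj cimg opprB addrCA subrr addr0 li ltr_pM2l.
    have lt b : b != i -> l j1.+1 b < l j1.+1 a.
      move=> bi; apply: lt_le_trans (jmin j1.+1).
      by apply: le_lt_trans (le1 _ _ _ bi) _; rewrite ltrBlDr -ltrBlDl.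
    have [ia|ia] := eqVneq i a; first by rewrite -ia in lt *.
    by have := lt a; rewrite eq_sym ia ltxx => /(_ isT).
  (* The two critical value gaps have total length more than 1, so at time j + 1 a gap other than
     [a] would be shorter than the minimum [l j1.+1 (c j1)]. *)
  - have [b ba] := other a.
    have := gmin j.+1 b; have := le1 j.+1 _ _ ba.
    by move: h; rewrite cimg1 -cj cimg mulrDr; lra.
  (* Here the image of gap [i] leaves to the critical value gap at time j + 1 less than the minimum
     [l j1.+1 (c j1)]. *)
  - have := le1 j.+1 i (c j); rewrite eq_sym ic (l_expand ic) => /(_ isT).
    have := gmin j.+1 (c j).
    have : d * (1 - l j1 (c j1)) < d * l j i by rewrite ltr_pM2l.
    rewrite cimg1; lra.
(* With at least four labels two remain outside [c j1] and [c (j1 + p)], and each would be strictly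
   longer than the other. *)
pose S := ([set~ c j1] :\ c (j1 + p)%N)%SET.
have S2 : (1 < #|S|)%N.
  have := cardsD1 (c (j1 + p)%N) [set~ c j1]%SET.
  rewrite cardsC1 card_ord -/S; lia.
have [x [y [xS yS xy]]] := card_gt1P S2.
move: xS yS; rewrite !inE => /andP[x2 x1] /andP[y2 y1].
have := lt_trans (key x x1 x2 y _) (key y y1 y2 x _).
by rewrite ltxx xy eq_sym xy => /(_ isT isT).
Qed.

End gap_dynamics.

(** * Finite subsets of the circle *)

(* A finite subset of [R/Z] with [n] elements, as the increasing enumeration
   of its preimage in [R]. *)
Record circle_lift (R : realType) (n : nat) (X : int -> R) : Prop := CircleLift {
  lift_incr : forall i, X i < X (i + 1) ;
  lift_addn : forall i, X (i + n%:Z) = X i + 1 }.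

Record unlinked (R : realType) (X Y : int -> R) : Prop := Unlinked {
  unlinked_neq : forall i k, X i != Y k ;
  unlinked_cross : forall i1 i2 k1 k2,
    ~ [/\ X i1 < Y k1, Y k1 < X i2, X i2 < Y k2 & Y k2 < X i1 + 1] }.

Lemma divz_succ (a m : int) : 0 < m ->
  ((a + 1) %/ m)%Z = (a %/ m)%Z \/
  ((a + 1) %/ m)%Z = (a %/ m)%Z + 1 /\ a + 1 = ((a %/ m)%Z + 1) * m.
Proof.
move=> m0; have m1 : m != 0 by rewrite gt_eqF.
have := modz_ge0 a m1; have := ltz_pmod a m0; have := divz_eq a m.
move: (a %/ m)%Z (a %% m)%Z => u v -> vm v0.
have [e|e] := eqVneq (v + 1) m; [right|left].
  have -> : u * m + v + 1 = (u + 1) * m by rewrite -e; ring.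
  by rewrite mulzK.
by rewrite -addrA divzMDl// divz_small ?addr0//; lia.
Qed.

Section circle_lift.
Variables (R : realType) (n : nat).
Implicit Types (X Y : int -> R).

Lemma lift_lt X : circle_lift n X -> forall i k, i < k -> X i < X k.
Proof.
move=> LX i k ik.
have [m ->] : exists m : nat, k = i + 1 + m%:Z.
  by exists (absz (k - i - 1)%R); lia.
elim: m => [|m IH]; first by rewrite addr0 (lift_incr LX).
by apply: lt_trans IH _; rewrite -addn1 PoszD addrA (lift_incr LX).
Qed.

Lemma lift_le X : circle_lift n X -> forall i k, i <= k -> X i <= X k.
Proof.
by move=> LX i k; rewrite le_eqVlt => /predU1P[->//|/(lift_lt LX)/ltW].
Qed.

Lemma lift_ltW X : circle_lift n X -> forall i k, X i < X k -> i < k.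
Proof.
by move=> LX i k; rewrite !ltNge; apply: contra => /(lift_le LX).
Qed.

Lemma lift_inj X : circle_lift n X -> injective X.
Proof.
move=> LX i k e; apply/eqP; rewrite eq_le !leNgt.
by apply/andP; split; apply/negP => /(lift_lt LX); rewrite e ltxx.
Qed.

Lemma lift_addnM X : circle_lift n X ->
  forall i m, X (i + m * n%:Z) = X i + m%:~R.
Proof.
move=> LX i.
have pos (m : nat) k : X (k + m%:Z * n%:Z) = X k + m%:R.
  elim: m => [|m IH]; first by rewrite mul0r !addr0.
  by rewrite -addn1 PoszD mulrDl mul1r addrA (lift_addn LX) IH natrD addrA.
case=> m; first exact: pos.
rewrite NegzE; have := pos m.+1 (i + - m.+1%:Z * n%:Z).
by rewrite -addrA -mulrDl addNr mul0r addr0 => ->; rewrite mulrNz addrK.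
Qed.

Lemma lift_shift X (s : R) : circle_lift n X -> circle_lift n (fun i => X i + s).
Proof.
by case=> h1 h2; split=> i; rewrite ?ltrD2r ?h1// h2 addrAC.
Qed.

(** A reflection of the circle reverses the order; reversing the index restores an increasing
    enumeration. *)
Lemma lift_opp X : circle_lift n X -> circle_lift n (fun i => - X (- i)).
Proof.
move=> LX; split=> i.
  by rewrite ltrN2; apply: (lift_lt LX); lia.
have -> : - i = - (i + n%:Z) + n%:Z by lia.
by rewrite (lift_addn LX); lra.
Qed.

Lemma lift_locate X : circle_lift n X ->
  forall y, exists i, X i <= y < X (i + 1).
Proof.
move=> LX y; pose m := Num.floor (y - X 0).
have a : X (m * n%:Z) <= y.
  by rewrite -[_ * _]add0r (lift_addnM LX) -lerBrDl floor_le.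
have b : y < X (m * n%:Z + n%:Z).
  rewrite (lift_addn LX) -[_ * _]add0r (lift_addnM LX) -addrA -ltrBlDl.
  by have := floorD1_gt (y - X 0); rewrite intrD.
elim: n (m * n%:Z) a b => [|k IH] i a b.
  by move: b; rewrite addr0 ltNge a.
have [c|c] := ltP y (X (i + 1)); first by exists i; rewrite a c.
by apply: (IH (i + 1)) => //; move: b; rewrite -addn1 PoszD [k%:Z + _]addrC addrA.
Qed.

Lemma unlinked_sym X Y : circle_lift n X -> circle_lift n Y ->
  unlinked X Y -> unlinked Y X.
Proof.
move=> LX LY [h1 h2]; split=> [i k|i1 i2 k1 k2 [a b c e]].
  by rewrite eq_sym h1.
apply: (h2 k1 k2 i2 (i1 + n%:Z)); rewrite (lift_addn LY); split=> //.
by rewrite ltrD2r.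
Qed.

Lemma unlinked_shift X Y (s : R) : unlinked X Y ->
  unlinked (fun i => X i + s) (fun i => Y i + s).
Proof.
move=> [h1 h2]; split=> [i k|i1 i2 k1 k2].
  by rewrite (inj_eq (addIr s)) h1.
by rewrite addrAC !ltrD2r; exact: h2.
Qed.

(** The ends of the gap would separate [Y k0] from a point of [Y] outside it. So one gap of [X],
    taken modulo 1, holds all of [Y]. *)
Lemma unlinked_in_gap X Y i k0 : (1 < n)%N ->
  circle_lift n X -> circle_lift n Y -> unlinked X Y ->
  X i < Y k0 < X (i + 1) ->
  forall k, exists m : int, X i + m%:~R < Y k < X (i + 1) + m%:~R.
Proof.
move=> n1 LX LY [h1 h2] /andP[a b] k.
pose m := Num.floor (Y k - X i); exists m.
have e1 : X i + m%:~R <= Y k by rewrite -lerBrDl floor_le.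
have e2 : Y k < X i + m%:~R + 1.
  by rewrite -addrA -ltrBlDl; have := floorD1_gt (Y k - X i); rewrite intrD.
have shift j : X j + m%:~R = X (j + m * n%:Z) by rewrite (lift_addnM LX).
have Yk : Y k - m%:~R = Y (k - m * n%:Z).
  by rewrite -mulNr (lift_addnM LY) mulrNz.
rewrite lt_neqAle e1 andbT shift h1/= ltNge; apply/negP => e3.
apply: (h2 i (i + 1) k0 (k - m * n%:Z)); split=> //.
- rewrite -Yk ltrBrDr lt_neqAle e3 andbT shift; exact: h1.
- by rewrite -Yk ltrBlDr addrAC.
Qed.

(** The translate lies in a single gap [c] of [X]. Its point X (c + 1) + e is beyond X (c + 1),
    hence in a later copy of that gap, beyond X (c + n). For e = 1/d this finds the critical gap. *)
Lemma unlinked_translate_critical X (e : R) : (1 < n)%N -> 0 < e ->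
  circle_lift n X -> unlinked X (fun i => X i + e) ->
  exists c, X (c + n%:Z) - X (c + 1) < e.
Proof.
move=> n1 e0 LX SX; have LXe := lift_shift e LX.
have [c /andP[c1 c2]] := lift_locate LX (X 0 + e).
have c3 : X c < X 0 + e < X (c + 1).
  by rewrite c2 andbT lt_neqAle c1 andbT (unlinked_neq SX _ 0).
have [m /andP[m1 m2]] := unlinked_in_gap n1 LX LXe SX c3 (c + 1).
exists c; rewrite (lift_addn LX) ltrBlDl; apply: le_lt_trans m1.
have : 0 < m by rewrite -(ltr0z R); lra.
by rewrite lerD2l gtz0_ge1 ler1z.
Qed.

Lemma hull_in_gap X Y cX cY (e : R) : (1 < n)%N -> e <= 2^-1 ->
  circle_lift n X -> circle_lift n Y -> unlinked X Y ->
  X (cX + n%:Z) - X (cX + 1) < e -> Y (cY + n%:Z) - Y (cY + 1) < e ->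
  X (cX + 1) < Y (cY + 1) < X (cX + n%:Z) ->
  exists2 i, cX < i < cX + n%:Z &
    Y (cY + n%:Z) - Y (cY + 1) < X (i + 1) - X i.
Proof.
move=> n1 e2 LX LY SXY wX wY /andP[a b].
have [i /andP[i1 i2]] := lift_locate LX (Y (cY + 1)).
have {}i1 : X i < Y (cY + 1) by rewrite lt_neqAle i1 (unlinked_neq SXY).
have ci : cX < i by have := lift_ltW LX (lt_trans a i2); lia.
have ic : i < cX + n%:Z by exact: lift_ltW LX _ _ (lt_trans i1 b).
exists i; first by rewrite ci ic.
have g : X i < Y (cY + 1) < X (i + 1) by rewrite i1.
have [m /andP[m1 m2]] := unlinked_in_gap n1 LX LY SXY g (cY + n%:Z).
have l1 : X (cX + 1) <= X i by apply: (lift_le LX); rewrite lezD1.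
have l2 : X (i + 1) <= X (cX + n%:Z) by apply: (lift_le LX); rewrite lezD1.
have l3 : Y (cY + 1) <= Y (cY + n%:Z).
  by apply: (lift_le LY); rewrite lerD2l lez_nat ltnW.
(* Both hulls are shorter than half a turn, so the end of the hull of [Y] cannot be in another copy
   of gap [i] than its start. *)
suff m0 : m = 0 by move: m2; rewrite m0 addr0; lra.
have [mp|mn|//] := ltgtP 0 m; exfalso.
  have : 1 <= m%:~R :> R by rewrite ler1z -gtz0_ge1.
  lra.
have : (m + 1)%:~R <= 0 :> R by rewrite lerz0 lezD1.
rewrite intrD.
lra.
Qed.

(** A translation of [Y] by a multiple of 1/d makes its hull start less than 1/d after that of [X].
    If it starts inside the hull of [X], it lies in a gap of [X]. If it ends beyond the start of X +
    1/d, the hull of X + 1/d lies in a gap of [Y]. Otherwise the two hulls fit side by side in an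
    interval of length 1/d. After multiplication by [d] the hulls become the complements of the
    critical value gaps, which are therefore nested or cover the circle. *)
Lemma hull_trichotomy X Y cX cY (d : R) : (1 < n)%N -> 2 <= d ->
  circle_lift n X -> circle_lift n Y ->
  (forall k : int, unlinked X (fun i => Y i + k%:~R / d)) ->
  X (cX + n%:Z) - X (cX + 1) < d^-1 -> Y (cY + n%:Z) - Y (cY + 1) < d^-1 ->
  [\/ exists2 i, cX < i < cX + n%:Z &
        Y (cY + n%:Z) - Y (cY + 1) < X (i + 1) - X i,
      d * ((X (cX + n%:Z) - X (cX + 1)) + (Y (cY + n%:Z) - Y (cY + 1))) < 1
    | exists2 i, cY < i < cY + n%:Z &
        X (cX + n%:Z) - X (cX + 1) < Y (i + 1) - Y i].
Proof.
move=> n1 d2 LX LY S wX wY.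
have d0 : 0 < d by lra.
have dh : d^-1 <= 2^-1 by rewrite lef_pV2 ?posrE//; lra.
pose k := - Num.floor (d * (Y (cY + 1) - X (cX + 1))).
pose Z i := Y i + k%:~R / d.
have LZ : circle_lift n Z by exact: lift_shift.
have wZ a b : Y a - Y b = Z a - Z b by rewrite /Z opprD addrACA subrr addr0.
have fl := floor_le (d * (Y (cY + 1) - X (cX + 1))).
have fu := floorD1_gt (d * (Y (cY + 1) - X (cX + 1))); rewrite intrD in fu.
have ZE i : d * Z i = d * Y i + k%:~R.
  by rewrite /Z mulrDr mulrCA divff ?mulr1 ?gt_eqF.
have k1 : X (cX + 1) <= Z (cY + 1).
  by rewrite -(ler_pM2l d0) ZE /k mulrNz; lra.
have k2 : Z (cY + 1) < X (cX + 1) + d^-1.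
  by rewrite -(ltr_pM2l d0) ZE /k mulrNz [ltRHS]mulrDr divff ?gt_eqF//; lra.
have {}k1 : X (cX + 1) < Z (cY + 1) by rewrite lt_neqAle k1 (unlinked_neq (S k)).
have SZ : unlinked Z (fun i => X i + d^-1).
  apply: (unlinked_sym (lift_shift _ LX) LZ).
  have := unlinked_shift d^-1 (S (k - 1)).
  congr unlinked; apply: funext => i.
  by rewrite /Z intrD mulrBl div1r addrA subrK.
rewrite wZ in wY *.
have [h|h] := ltP (Z (cY + 1)) (X (cX + n%:Z)).
  by apply: Or31; apply: (hull_in_gap n1 dh LX LZ (S k)) => //; rewrite k1.
have [h2|h2] := ltP (X (cX + 1) + d^-1) (Z (cY + n%:Z)).
  apply: Or33.
  have [] := @hull_in_gap Z (fun i => X i + d^-1) cY cX _ n1 dh LZ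
     (lift_shift _ LX) SZ wY.
  - by rewrite /= opprD addrACA subrr addr0.
  - by rewrite k2 h2.
  - by move=> i hi; rewrite /= opprD addrACA subrr addr0 -wZ => ?; exists i.
apply: Or32; rewrite -(divff (lt0r_neq0 d0)) ltr_pM2l//.
have : X (cX + n%:Z) != Z (cY + 1) := unlinked_neq (S k) _ _.
rewrite neq_lt [X in _ || X]ltNge h orbF => ?; lra.
Qed.

(** The index map [g] is strictly increasing and advances by n over n steps, so each step is exactly
    1. *)
Lemma lift_range_shift X Y : circle_lift n X -> circle_lift n Y ->
  (forall i, exists k, X i = Y k) -> exists s, forall i, X i = Y (i + s).
Proof.
move=> LX LY /choice[g gP].
have g1 i : g i + 1 <= g (i + 1).
  by rewrite lezD1; apply: (lift_ltW LY); rewrite -!gP (lift_incr LX).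
have gn i : g (i + n%:Z) = g i + n%:Z.
  by apply: (lift_inj LY); rewrite -gP (lift_addn LX) (lift_addn LY) gP.
have gm i (m : nat) : g i + m%:Z <= g (i + m%:Z).
  elim: m => [|m IH]; first by rewrite !addr0.
  by rewrite -addn1 PoszD !addrA (le_trans _ (g1 _))// lerD2r.
have n0 : (0 < n)%N.
  by case: n LX => // LX0; have := lift_addn LX0 0; rewrite addr0; lra.
have gE i : g (i + 1) = g i + 1.
  have := gm (i + 1) n.-1.
  rewrite (_ : i + 1 + n.-1%:Z = i + n%:Z); last by lia.
  rewrite gn; have := g1 i; move: (g (i + 1)) (g i) => u v; lia.
exists (g 0) => i; rewrite gP; congr Y.
have pos (m : nat) j : g (j + m%:Z) = m%:Z + g j.
  elim: m => [|m IH]; first by rewrite addr0 add0r.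
  by rewrite -addn1 PoszD addrA gE IH; lia.
case: i => m; first by have := pos m 0; rewrite add0r.
by rewrite NegzE; have := pos m.+1 (- m.+1%:Z); rewrite addNr; move: (g _) (g _) => u v; lia.
Qed.

(** Multiplication by [d] stretches one turn to d turns. The excess of d - 1 turns is removed at
    each passage of the critical gap, counted by [q]; what is left of that gap is positive because
    the hull is shorter than 1/d. *)
Lemma lift_expand X c (d : nat) : (1 < n)%N -> (0 < d)%N -> circle_lift n X ->
  X (c + n%:Z) - X (c + 1) < d%:R^-1 ->
  exists2 Y, circle_lift n Y & forall i, Y i - d%:R * X i \is a Num.int.
Proof.
move=> n1 d0 LX wX.
pose q i : int := ((i - c - 1) %/ n%:Z)%Z.
have d0R : 0 < d%:R :> R by rewrite ltr0n.
exists (fun i => d%:R * X i - (d.-1%:Z * q i)%:~R); last first.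
  by move=> i; rewrite addrAC subrr add0r rpredN intr_int.
have dE : d%:R = (d.-1)%:R + 1 :> R by rewrite natr1 prednK.
split=> i; last first.
  have -> : q (i + n%:Z) = q i + 1.
    rewrite /q (_ : i + _ - _ - _ = 1 * n%:Z + (i - c - 1)); last by ring.
    by rewrite divzMDl 1?addrC// gt_eqF// ltz_nat ltnW.
  rewrite (lift_addn LX) mulrDr !intrM intrD.
  by rewrite dE; ring.
have n0 : 0 < n%:Z by rewrite ltz_nat ltnW.
have [e|[e iE]] := divz_succ (i - c - 1) n0.
  have -> : q (i + 1) = q i by rewrite /q -e; congr (_ %/ _)%Z; ring.
  by rewrite ltrD2r ltr_pM2l// (lift_incr LX).
have -> : q (i + 1) = q i + 1 by rewrite /q -e; congr (_ %/ _)%Z; ring.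
have -> : X (i + 1) = X (c + 1) + 1 + (q i)%:~R.
  rewrite -(lift_addn LX) -(lift_addnM LX); congr X.
  apply: (addIr (- c - 1)); rewrite [LHS](_ : _ = i - c - 1 + 1); last by ring.
  by rewrite iE /q; ring.
have -> : X i = X (c + n%:Z) + (q i)%:~R.
  rewrite -(lift_addnM LX); congr X.
  apply: (addIr (- c)); rewrite [LHS](_ : _ = i - c - 1 + 1); last by ring.
  by rewrite iE /q; ring.
have := wX; rewrite -(ltr_pM2l d0R) divff ?gt_eqF// => {}wX.
rewrite -subr_gt0 (_ : _ - _ = 1 - d%:R * (X (c + n%:Z) - X (c + 1))) ?subr_gt0//.
by rewrite !intrM intrD dE -[d.-1%:~R]/(d.-1%:R); ring.
Qed.
End circle_lift.

Lemma int_lt1_eq0 (R : realType) (x : R) : x \is a Num.int -> -1 < x < 1 -> x = 0.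
Proof.
case/intrP => m -> /andP[a b].
suff -> : m = 0 by [].
have : -1 < m by rewrite -(ltr_int R).
have : m < 1 by rewrite -(ltr_int R).
lia.
Qed.

Lemma int_congr (R : realType) (x y : R) : x = y ->
  x \is a Num.int -> y \is a Num.int.
Proof. by move=> ->. Qed.

(* Multiplication by [- d] reverses orientation; the lifts [X j] follow [d ^ j]
   instead, so that the actual angles at time [j] are [(-1) ^ j * X j i].  The
   oddness of the period is what [X_reflect] expresses. *)
Section lift_dynamics.
Variables (R : realType) (n d p : nat) (X : nat -> int -> R).
Hypotheses (d2 : (2 <= d)%N) (p0 : (0 < p)%N).
Hypothesis X_lift : forall j, circle_lift n (X j).
Hypothesis X_expand : forall j i, X j i - d%:R ^+ j * X 0%N i \is a Num.int.
Hypothesis X_reflect : forall i, exists k, - X p (- i) = X 0%N k.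
Hypothesis X_hull : forall j, exists c, X j (c + n%:Z) - X j (c + 1) < d%:R^-1.
(** The actual angles carry the sign (-1)^j. For [j] and [k] of the same parity the lifts compare
    directly; for opposite parities one of them is reflected. *)
Hypothesis X_sep : forall j k, j != k %[mod p] ->
  (forall m : int, unlinked (X j) (fun i => X k i + m%:~R / d%:R)) \/
  (forall m : int, unlinked (X j) (fun i => - X k (- i) + m%:~R / d%:R)).

(* The first return map is a reflection, hence an involution. *)
Lemma return_square_id i : d%:R ^+ p.*2 * X 0%N i - X 0%N i \is a Num.int.
Proof.
have [s sP] := lift_range_shift (lift_opp (X_lift p)) (X_lift 0) X_reflect.
have Xp k : X p k = - X 0%N (s - k).
  by rewrite addrC -sP !opprK.
have h1 : d%:R ^+ p * (X p i - d%:R ^+ p * X 0%N i) \is a Num.int.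
  by rewrite rpredM// rpredX// intr_nat.
apply: int_congr (rpredB (X_expand p (s - i)) h1).
rewrite !Xp subKr -addnn exprD; ring.
Qed.

Lemma gap_int_expand j k e i : (forall i, X k i - d%:R ^+ e * X j i \is a Num.int) ->
  (X k (i + 1) - X k i) - d%:R ^+ e * (X j (i + 1) - X j i) \is a Num.int.
Proof.
by move=> h; apply: int_congr (rpredB (h (i + 1)) (h i)); ring.
Qed.

Lemma gap_lt1 j i : (1 < n)%N -> 0 < X j (i + 1) - X j i < 1.
Proof.
move=> n1; rewrite subr_gt0 (lift_incr (X_lift j)) ltrBlDl.
rewrite -(lift_addn (X_lift j)); apply: (lift_lt (X_lift j)).
by rewrite ltrD2l ltz_nat.
Qed.

(** Reduction to the gap dynamics. The lifts are known only modulo integers, but gaps lie strictly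
    between 0 and 1, as do noncritical gaps multiplied by [d], so congruences between their lengths
    are equalities. *)
Lemma lift_dynamics_valence : (n <= 3)%N.
Proof.
have [n1|/leq_trans->//] := ltnP 1 n.
have d0 : 0 < d%:R :> R by rewrite ltr0n ltnW.
have mulnz (k : nat) (x : R) : x \is a Num.int -> k%:R * x \is a Num.int.
  by move=> ?; rewrite rpredM// intr_nat.
have /choice[c cP] : forall j, exists k : 'I_n,
    X j (k%:Z + n%:Z) - X j (k%:Z + 1) < d%:R^-1.
  move=> j; have [a aP] := X_hull j.
  have n0 : n%:Z != 0 by rewrite gt_eqF// ltz_nat ltnW.
  have [b bE] : exists b : nat, (a %% n%:Z)%Z = b%:Z.
    by exists (absz (a %% n%:Z)%Z); rewrite gez0_abs// modz_ge0.
  have bn : (b < n)%N by rewrite -ltz_nat -bE ltz_pmod// ltz_nat ltnW.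
  exists (Ordinal bn); rewrite /= -bE.
  have aE m : X j (a + m) = X j ((a %% n%:Z)%Z + m) + (a %/ n%:Z)%Z%:~R.
    rewrite -(lift_addnM (X_lift j)); congr (X j); rewrite {1}(divz_eq a n%:Z); ring.
  by move: aP; rewrite !aE opprD addrACA subrr addr0.
have wid j i : X j (i + n%:Z) = X j i + 1 := lift_addn (X_lift j) i.
pose l j (i : 'I_n) := X j (i%:Z + 1) - X j i%:Z.
have lc j : 1 - l j (c j) = X j ((c j)%:Z + n%:Z) - X j ((c j)%:Z + 1).
  by rewrite wid /l; ring.
have linner j (i : int) k : k < i < k + n%:Z ->
    X j (i + 1) - X j i <= X j (k + n%:Z) - X j (k + 1).
  by move=> /andP[a b]; apply: lerB; apply: (lift_le (X_lift j)); rewrite lezD1.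
have lint j (i : 'I_n) : i != c j -> X j (i%:Z + 1) - X j i%:Z < d%:R^-1.
  move=> ic; apply: le_lt_trans (cP j).
  have [cli|icl] := ltP (c j)%:Z i%:Z.
    apply: linner; rewrite cli/=.
    by rewrite (@lt_le_trans _ _ n%:Z) ?ltz_nat ?lerDr.
  have -> : X j (i%:Z + 1) - X j i%:Z = X j (i%:Z + n%:Z + 1) - X j (i%:Z + n%:Z).
    by rewrite addrAC !wid; ring.
  have {}icl : i%:Z < (c j)%:Z by rewrite lt_neqAle icl andbT eqz_nat (inj_eq val_inj).
  apply: linner; rewrite ltrD2r icl andbT.
  by rewrite (@lt_le_trans _ _ n%:Z) ?ltz_nat ?lerDr.
have mod_ord (i : int) : exists m : 'I_n, i = m%:Z + (i %/ n%:Z)%Z * n%:Z.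
  have n0 : n%:Z != 0 by rewrite gt_eqF// ltz_nat ltnW.
  have [b bE] : exists b : nat, (i %% n%:Z)%Z = b%:Z.
    by exists (absz (i %% n%:Z)%Z); rewrite gez0_abs// modz_ge0.
  have bn : (b < n)%N by rewrite -ltz_nat -bE ltz_pmod// ltz_nat ltnW.
  by exists (Ordinal bn); rewrite /= -bE addrC -divz_eq.
have transport j (i : int) (k : 'I_n) : k%:Z < i < k%:Z + n%:Z ->
    exists2 m : 'I_n, m != k & X j (i + 1) - X j i = l j m.
  have [m iE] := mod_ord i => ki; exists m.
    apply/eqP => mk; move: ki; rewrite iE mk.
    set q := (_ %/ _)%Z => /andP[a b].
    have q0 : 0 < q by move: a; rewrite ltrDl pmulr_lgt0// ltz_nat ltnW.
    move: b; rewrite ltrD2l gtr_pMl ?ltz_nat 1?ltnW//.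
    by rewrite ltNge -gtz0_ge1 q0.
  by rewrite {1 2}iE addrAC !(lift_addnM (X_lift j)) /l; ring.
apply: (@gap_dynamics_valence R n d%:R p l c) => //.
- by rewrite ltr1n.
- by move=> j i; have /andP[] := gap_lt1 j i n1.
- move=> j; have := wid j 0; rewrite add0r => /eqP; rewrite addrC -subr_eq => /eqP <-.
  have : forall m : nat, \sum_(i < m) (X j (i%:Z + 1) - X j i%:Z) = X j m%:Z - X j 0.
    elim=> [|m IH]; first by rewrite big_ord0 subrr.
    by rewrite big_ord_recr/= IH -addn1 PoszD; ring.
  exact.
- move=> j i ic; apply/eqP; rewrite -subr_eq0; apply/eqP; apply: int_lt1_eq0.
    apply: (@gap_int_expand j j.+1 1) => k; rewrite expr1.
    have h := mulnz d _ (X_expand j k).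
    by apply: int_congr (rpredB (X_expand j.+1 k) h); rewrite exprS; ring.
  have /andP[a b] := gap_lt1 j.+1 i n1.
  have /andP[e _] := gap_lt1 j i n1.
  have := lint j i ic; rewrite -(ltr_pM2l d0) divff ?gt_eqF// -/(l j i) => f.
  have : 0 < d%:R * l j i by rewrite mulr_gt0.
  by move: a b; rewrite -/(l j.+1 i); lra.
- move=> j i; apply/eqP; rewrite -subr_eq0; apply/eqP; apply: int_lt1_eq0.
    have := (@gap_int_expand j (j + p.*2) 0 i); rewrite expr0 mul1r; apply=> k.
    rewrite mul1r.
    have h : d%:R ^+ j * (d%:R ^+ p.*2 * X 0 k - X 0 k) \is a Num.int.
      by apply: rpredM (return_square_id k); rewrite rpredX ?intr_nat.
    apply: int_congr (rpredB (rpredD (X_expand (j + p.*2) k) h) (X_expand j k)).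
    by rewrite exprD; ring.
  have /andP[] := gap_lt1 (j + p.*2) i n1; have /andP[] := gap_lt1 j i n1.
  by rewrite /l; lra.
- move=> j k jk; rewrite !lc.
  have d2R : 2 <= d%:R :> R by rewrite ler_nat.
  have [S|S] := X_sep jk.
    have [[i h e]|h|[i h e]] :=
      hull_trichotomy n1 d2R (X_lift j) (X_lift k) S (cP j) (cP k).
    + by apply: Or31; have [m ? mE] := transport j _ _ h; exists m; rewrite -?mE.
    + exact: Or32.
    + by apply: Or33; have [m ? mE] := transport k _ _ h; exists m; rewrite -?mE.
  (* Reflection turns the gap of index [i] into the gap of index - i - 1. One turn is subtracted so
     that the ends of the hull are exchanged exactly, as [c1] and [c2] state. *)
  pose c' := - (c k)%:Z - n%:Z - 1.
  have c1 : - (c' + 1) = (c k)%:Z + n%:Z by rewrite /c'; ring.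
  have c2 : - (c' + n%:Z) = (c k)%:Z + 1 by rewrite /c'; ring.
  have := hull_trichotomy n1 d2R (X_lift j) (lift_opp (X_lift k)) S (cP j).
  move=> /(_ c'); rewrite c1 c2 opprK [- _ + X k _]addrC => /(_ (cP k)).
  move=> [[i h e]|h|[i h e]].
  + by apply: Or31; have [m ? mE] := transport j _ _ h; exists m; rewrite -?mE.
  + exact: Or32.
  + apply: Or33.
    have h' : (c k)%:Z < - (i + 1) < (c k)%:Z + n%:Z.
      by move: h; rewrite -c1 /c' => /andP[]; lia.
    have [m ? mE] := transport k _ _ h'; exists m => //.
    rewrite -mE (_ : - (i + 1) + 1 = - i); last by ring.
    by apply: lt_le_trans e _; rewrite opprK addrC.
Qed.

End lift_dynamics.

(** * The complex plane *)

(** The norm of [R[i]] has values in [R[i]]; the real-valued version is the one that order reasoning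
    and [lra] can handle. *)
Definition cnorm (R : realType) (z : R[i]) : R := complex.Re `|z|.

Section cnorm.
Variable R : realType.
Implicit Types (z w : R[i]) (t : R).

Lemma cnormE z : `|z| = (cnorm z)%:C.
Proof. by rewrite /cnorm normc_def. Qed.

Lemma cnorm_def z : cnorm z = Num.sqrt (complex.Re z ^+ 2 + complex.Im z ^+ 2).
Proof. by rewrite /cnorm normc_def. Qed.

Lemma cnorm_ge0 z : 0 <= cnorm z.
Proof. by rewrite -ler0c -cnormE. Qed.

Lemma cnorm0 : cnorm 0 = 0 :> R.
Proof. by apply: complexI; rewrite -cnormE normr0. Qed.

Lemma cnorm_eq0 z : (cnorm z == 0) = (z == 0).
Proof. by rewrite -(inj_eq (@complexI _)) -cnormE normr_eq0. Qed.

Lemma cnorm_gt0 z : (0 < cnorm z) = (z != 0).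
Proof. by rewrite lt_neqAle cnorm_ge0 andbT eq_sym cnorm_eq0. Qed.

Lemma cnormM z w : cnorm (z * w) = cnorm z * cnorm w.
Proof. by apply: complexI; rewrite rmorphM/= -!cnormE normrM. Qed.

Lemma cnormX z n : cnorm (z ^+ n) = cnorm z ^+ n.
Proof. by apply: complexI; rewrite rmorphXn/= -!cnormE normrX. Qed.

Lemma cnormV z : cnorm z^-1 = (cnorm z)^-1.
Proof. by apply: complexI; rewrite fmorphV/= -!cnormE normfV. Qed.

Lemma cnormN z : cnorm (- z) = cnorm z.
Proof. by apply: complexI; rewrite -!cnormE normrN. Qed.

Lemma cnormB z w : cnorm (z - w) = cnorm (w - z).
Proof. by rewrite -cnormN opprB. Qed.

Lemma cnormJ z : cnorm z^* = cnorm z.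
Proof. by apply: complexI; rewrite -!cnormE normcJ. Qed.

Lemma cnorm_real (x : R) : cnorm x%:C = `|x|.
Proof. by rewrite cnorm_def/= expr0n addr0 sqrtr_sqr. Qed.

Lemma ler_cnormD z w : cnorm (z + w) <= cnorm z + cnorm w.
Proof. by rewrite -lecR rmorphD/= -!cnormE ler_normD. Qed.

Lemma ler_cnormB z w : cnorm z - cnorm w <= cnorm (z - w).
Proof. by rewrite lerBlDr -{1}(subrK w z) ler_cnormD. Qed.

Lemma ler_norm_Re z : `|complex.Re z| <= cnorm z.
Proof. by rewrite -lecR -cnormE normc_ge_Re. Qed.

Lemma cvgC (T : Type) (F : set_system T) {FF : Filter F} (f : T -> R[i]) (l : R[i]) :
  (f @ F --> l) <-> (forall e : R, 0 < e -> \forall x \near F, cnorm (l - f x) < e).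
Proof.
rewrite cvgrPdist_lt; split=> h e e0.
  have := h e%:C; rewrite ltcR => /(_ e0); apply: filterS => x.
  by rewrite cnormE ltcR.
have eE : e = (complex.Re e)%:C.
  by move: e0; rewrite ltcE/= => /andP[/eqP ee _]; case: e ee => a b /= ->.
have := h (complex.Re e); rewrite -ltcR -eE => /(_ e0); apply: filterS => x.
by rewrite cnormE eE ltcR.
Qed.

(* [cvgD] and [cvgM] apply to [R[i]] only after a very expensive unification. *)
Section cvg.
Variables (T : Type) (F : set_system T) (FF : Filter F).
Implicit Types f g : T -> R[i].

Lemma cvgC_cst z : (fun=> z) @ F --> z.
Proof.
by apply/cvgC => e e0; apply: filterE => x; rewrite subrr cnorm0.
Qed.

Lemma cvgCD f g z w : f @ F --> z -> g @ F --> w ->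
  (fun x => f x + g x) @ F --> z + w.
Proof.
move=> /cvgC fz /cvgC gw; apply/cvgC => e e0.
have e2 : 0 < e / 2 by rewrite divr_gt0.
apply: filterS2 (fz _ e2) (gw _ e2) => x h1 h2.
by rewrite opprD addrACA (le_lt_trans (ler_cnormD _ _))//; lra.
Qed.

Lemma cvgCN f z : f @ F --> z -> (fun x => - f x) @ F --> - z.
Proof.
move=> /cvgC fz; apply/cvgC => e e0; apply: filterS (fz _ e0) => x h.
by rewrite -opprD cnormN.
Qed.

Lemma cvgCB f g z w : f @ F --> z -> g @ F --> w ->
  (fun x => f x - g x) @ F --> z - w.
Proof. by move=> fz gw; exact: (cvgCD fz (cvgCN gw)). Qed.

Lemma cvgCM f g (z w : R[i]) : f @ F --> z -> g @ F --> w ->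
  (fun x => f x * g x) @ F --> z * w.
Proof.
move=> /cvgC fz /cvgC gw; apply/cvgC => e e0.
have := cnorm_ge0 z; have := cnorm_ge0 w => w0 z0.
have e1 : 0 < Num.min 1 (e / 2 / (cnorm z + 1)).
  by rewrite lt_min ltr01/= !divr_gt0//; lra.
have e2 : 0 < e / 2 / (cnorm w + 1) by rewrite !divr_gt0//; lra.
apply: filterS2 (fz _ e2) (gw _ e1) => x h1; rewrite lt_min => /andP[h2 h3].
rewrite (_ : _ - _ = z * (w - g x) + (z - f x) * g x); last by ring.
apply: le_lt_trans (ler_cnormD _ _) _; rewrite !cnormM.
have gx : cnorm (g x) <= cnorm w + 1.
  by have := ler_cnormB (g x) w; have := cnormB (g x) w; lra.
move: h1 h3; rewrite !ltr_pdivlMr; [|lra|lra|lra|lra] => h1 h3.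
have := cnorm_ge0 (w - g x); have := cnorm_ge0 (z - f x) => p1 p2.
have : cnorm (z - f x) * cnorm (g x) <= cnorm (z - f x) * (cnorm w + 1).
  exact: ler_wpM2l.
by lra.
Qed.

Lemma cvgCX f (z : R[i]) n : f @ F --> z ->
  (fun x => f x ^+ n) @ F --> z ^+ n.
Proof.
move=> fz; elim: n => [|n IH]; first exact: cvgC_cst.
rewrite exprS (_ : (fun x => _) = (fun x => f x * f x ^+ n)).
  exact: (cvgCM fz IH).
by apply/funext => x; rewrite exprS.
Qed.

Lemma cvgCJ f z : f @ F --> z -> (fun x => (f x)^*) @ F --> z^*.
Proof.
move=> /cvgC fz; apply/cvgC => e e0; apply: filterS (fz _ e0) => x h.
by rewrite -rmorphB/= cnormJ.
Qed.

Lemma cvgC_unique f z w : ProperFilter F -> f @ F --> z -> f @ F --> w -> z = w.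
Proof.
move=> PF /cvgC fz /cvgC fw; apply/eqP; apply/negPn/negP => zw.
have e0 : 0 < cnorm (z - w) / 2 by rewrite divr_gt0// cnorm_gt0 subr_eq0.
have [x [h1 h2]] := filter_ex (filterI (fz _ e0) (fw _ e0)).
have := ler_cnormD (z - f x) (f x - w); rewrite addrA subrK.
by have := cnormB (f x) w; lra.
Qed.

End cvg.

Lemma expturnD (a b : R) : expturn (a + b) = expturn a * expturn b.
Proof.
rewrite /expturn mulrDr cosD sinD; simpc.
by apply/eqP; rewrite eq_complex/= eqxx/= [_ * sin _ + _]addrC mulrC.
Qed.

Lemma expturn0 : expturn 0 = 1 :> R[i].
Proof. by rewrite /expturn mulr0 cos0 sin0. Qed.

Lemma cnorm_expturn t : cnorm (expturn t) = 1.
Proof. by rewrite cnorm_def/= cos2Dsin2 sqrtr1. Qed.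

Lemma expturn_neq0 t : expturn t != 0.
Proof. by rewrite -cnorm_gt0 cnorm_expturn. Qed.

Lemma expturnN t : expturn (- t) = (expturn t)^-1.
Proof.
apply: (mulfI (expturn_neq0 t)).
by rewrite -expturnD subrr expturn0 divff// expturn_neq0.
Qed.

Lemma expturnJ t : (expturn t)^* = expturn (- t).
Proof. by rewrite /expturn mulrN cosN sinN. Qed.

Lemma expturnMn t n : expturn t ^+ n = expturn (n%:R * t).
Proof.
elim: n => [|n IH]; first by rewrite mul0r expturn0 expr0.
by rewrite exprS IH -expturnD -natr1 mulrDl mul1r addrC.
Qed.

Lemma expturn_int t : t \is a Num.int -> expturn t = 1.
Proof.
have nat1 (n : nat) : expturn n%:R = 1 :> R[i].
  rewrite -[n%:R]mulr1 -expturnMn (_ : expturn 1 = 1) ?expr1n//.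
  by rewrite /expturn mulr1 mulrC mulr_natr cos2pi sin2pi.
case/intrP => [[n|n]] ->; first exact: nat1.
by rewrite NegzE mulrNz expturnN nat1 invr1.
Qed.

Lemma expturn_eq1 t : expturn t = 1 -> t \is a Num.int.
Proof.
move=> et; pose u := t - (Num.floor t)%:~R.
have eu : expturn u = 1.
  by rewrite /u expturnD et mul1r -rmorphN/= expturn_int ?intr_int.
have u0 : 0 <= u by rewrite subr_ge0 floor_le.
have u1 : u < 1.
  by rewrite /u ltrBlDl; have := floorD1_gt t; rewrite intrD.
have pi0 := pi_gt0 R.
have small (v : R) : 0 <= v <= 2^-1 -> cos (2 * pi * v) = 1 -> v = 0.
  move=> /andP[v0 v1] cv.
  have : 2 * pi * v = 0.
    apply: cos_inj; rewrite ?cos0// in_itv/= ?lexx ?pi_ge0//.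
    rewrite mulr_ge0 ?mulr_ge0 ?pi_ge0//=.
    by rewrite -mulrA mulrCA ger_pMr//; lra.
  by move/eqP; rewrite mulf_eq0 mulf_eq0 gt_eqF//= gt_eqF//= => /eqP.
have /eqP := eu; rewrite eq_complex/= => /andP[/eqP cu _].
suff u00 : u = 0 by move: u00 => /eqP; rewrite subr_eq0 => /eqP ->; exact: intr_int.
have [uh|uh] := leP u 2^-1; first by apply: small; rewrite ?u0.
have : 1 - u = 0.
  apply: small; first by lra.
  rewrite (_ : 2 * pi * (1 - u) = - (2 * pi * u) + pi *+ 2) ?cosD2pi ?cosN//.
  by rewrite mulr2n; ring.
lra.
Qed.

Lemma expturn_inj (a b : R) : expturn a = expturn b -> a - b \is a Num.int.
Proof.
move=> e; apply: expturn_eq1.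
by rewrite expturnD expturnN e divff// expturn_neq0.
Qed.

(** The component of [w] in the direction of angle [t]: it is positive exactly when [w] is nonzero
    with argument less than a quarter turn from [t]. *)
Definition dircomp (t : R) (w : R[i]) : R := complex.Re (w * expturn (- t)).

Lemma dircompD t z w : dircomp t (z + w) = dircomp t z + dircomp t w.
Proof. by rewrite /dircomp mulrDl raddfD. Qed.

Lemma dircompN t w : dircomp t (- w) = - dircomp t w.
Proof. by rewrite /dircomp mulNr raddfN. Qed.

Lemma ler_dircomp t w : `|dircomp t w| <= cnorm w.
Proof.
by apply: le_trans (ler_norm_Re _) _; rewrite cnormM cnorm_expturn mulr1.
Qed.

Lemma dircomp_polar t (r a : R) : dircomp t (r%:C * expturn a) = r * cos (2 * pi * (a - t)).
Proof.
rewrite /dircomp -mulrA -expturnD /expturn.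
by rewrite -[_ * (_ +i* _)]/(_ +i* _)/= mul0r subr0.
Qed.

Lemma polar_right_half w : 0 < complex.Re w ->
  exists2 t, `|t| < 4^-1 & w = (cnorm w)%:C * expturn t.
Proof.
case: w => x y /= x0; pose s := atan (y / x); exists (s / (2 * pi)).
  have := atan_gtNpi2 (y / x); have := atan_ltpi2 (y / x).
  have pi0 := pi_gt0 R; rewrite -/s => h1 h2.
  rewrite ltr_norml ltr_pdivlMr ?mulr_gt0// ltr_pdivrMr ?mulr_gt0//.
  by apply/andP; split; lra.
have e : 2 * pi * (s / (2 * pi)) = s.
  by rewrite mulrCA divff ?mulr1// gt_eqF// mulr_gt0// pi_gt0.
have cs : cos s != 0.
  rewrite cos_atan invr_eq0 gt_eqF// sqrtr_gt0.
  by rewrite (lt_le_trans ltr01)// lerDl sqr_ge0.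
have ss : sin s = y / x * cos s.
  by rewrite -[y / x](atanK (y / x)) -/s /tan divfK.
have nE : cnorm (x +i* y) = x / cos s.
  rewrite cnorm_def/= cos_atan invrK -{2}(gtr0_norm x0) -sqrtr_sqr -sqrtrM ?sqr_ge0//.
  by rewrite mulrDr mulr1 -exprMn mulrC divfK// gt_eqF.
rewrite nE /expturn e.
rewrite -[_ * (_ +i* _)]/(_ +i* _) !mul0r subr0 addr0 divfK// ss.
by congr (_ +i* _); field; rewrite cs gt_eqF.
Qed.

Lemma polar w : exists t, w = (cnorm w)%:C * expturn t.
Proof.
have [re|re|re] := ltgtP 0 (complex.Re w).
- by have [t _ wt] := polar_right_half re; exists t.
- have : 0 < complex.Re (- w) by rewrite raddfN/= oppr_gt0.
  move=> /polar_right_half[t _ wt]; exists (t + 2^-1).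
  rewrite expturnD mulrA -[X in X%:C * _]cnormN -wt.
  rewrite /expturn mulrAC divff// mul1r cospi sinpi.
  by rewrite [_ +i* _](_ : _ = -1) ?mulrNN ?mulr1//; simpc.
- have [w0|w0] := eqVneq w 0.
    by exists 0; rewrite w0 cnorm0 mul0r.
  have e4 : 2 * pi * 4^-1 = pi / 2 :> R by field.
  case: w re w0 => x y /= <- w0; have [y0|y0] := leP 0 y.
    exists 4^-1; rewrite cnorm_def/= expr0n add0r sqrtr_sqr ger0_norm//.
    rewrite /expturn e4 cos_pihalf sin_pihalf.
    by rewrite -[_ * (_ +i* _)]/(_ +i* _) !mul0r !mulr0 subr0 addr0 mulr1.
  exists (- 4^-1); rewrite cnorm_def/= expr0n add0r sqrtr_sqr ltr0_norm//.
  rewrite /expturn mulrN e4 cosN sinN cos_pihalf sin_pihalf.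
  by rewrite -[_ * (_ +i* _)]/(_ +i* _) !mul0r !mulr0 subr0 addr0 mulrNN mulr1.
Qed.

Lemma right_half_polar t : 0 < complex.Re (expturn t) ->
  exists m : int, `|t - m%:~R| < 4^-1.
Proof.
move=> /polar_right_half[s s4]; rewrite cnorm_expturn mul1r => /expturn_inj.
by case/intrP => m e; exists m; rewrite -e opprB addrCA subrr addr0.
Qed.

Lemma dircomp_gt0_near a t (r : R) : 0 < dircomp a (r%:C * expturn t) -> 0 <= r ->
  exists m : int, `|t - a - m%:~R| < 4^-1.
Proof.
rewrite dircomp_polar => h r0; apply: right_half_polar => /=.
by rewrite ltNge; apply/negP => c; move: h; rewrite ltNge mulr_ge0_le0.
Qed.

End cnorm.

(** * Winding numbers on the unit square *)

Section square_lift.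
Variable R : realType.

Lemma int_near_eq (m k : int) (x : R) : `|x - m%:~R| < 4^-1 ->
  `|x - k%:~R| < 3 / 4 -> m = k.
Proof.
rewrite !ltr_norml => /andP[a b] /andP[c e]; apply/eqP; rewrite -subr_eq0.
rewrite -(eqr_int R) intrB; apply/eqP; apply: int_lt1_eq0; last lra.
by rewrite rpredB ?intr_int.
Qed.

(** The argument is lifted along the line i = 0, then along each line of constant [j]. On the
    remaining edges one goes cell by cell: the four increments around a cell, each below a quarter
    turn, add up to an integer of absolute value less than 1, hence to 0. *)
Lemma grid_lift (h : nat -> nat -> R[i]) (N M : nat) :
  (forall i j, (i <= N)%N -> (j <= M)%N -> h i j != 0) ->
  (forall i j, (i < N)%N -> (j <= M)%N -> 0 < complex.Re (h i.+1 j / h i j)) ->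
  (forall i j, (i <= N)%N -> (j < M)%N -> 0 < complex.Re (h i j.+1 / h i j)) ->
  exists L : nat -> nat -> R,
  [/\ forall i j, (i <= N)%N -> (j <= M)%N ->
        h i j = (cnorm (h i j))%:C * expturn (L i j),
      forall i j, (i < N)%N -> (j <= M)%N -> `|L i.+1 j - L i j| < 4^-1
    & forall i j, (i <= N)%N -> (j < M)%N -> `|L i j.+1 - L i j| < 4^-1].
Proof.
move=> h0 hh hv.
have /choice[ang angP] : forall w : R[i], exists t, w = (cnorm w)%:C * expturn t /\
    (0 < complex.Re w -> `|t| < 4^-1).
  move=> w; have [/polar_right_half[t t4 wt]|re] := ltP 0 (complex.Re w).
    by exists t.
  by have [t wt] := polar w; exists t; split=> // /lt_geF; rewrite re.
pose L0 := fix L0 j := if j is k.+1 then L0 k + ang (h 0%N k.+1 / h 0%N k)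
  else ang (h 0%N 0%N).
pose L := fix L i j := if i is k.+1 then L k j + ang (h k.+1 j / h k j) else L0 j.
have step (w w' : R[i]) t : w != 0 -> w = (cnorm w)%:C * expturn t ->
    w' = (cnorm w')%:C * expturn (t + ang (w' / w)).
  move=> w0 wt; have [wt' _] := angP (w' / w).
  rewrite -{1}(divfK w0 w') {1}wt' [X in _ * X = _]wt expturnD cnormM cnormV.
  rewrite [LHS]mulrACA -rmorphM/= divfK ?cnorm_eq0//.
  by rewrite [expturn (ang _) * _]mulrC.
have hL0 j : (j <= M)%N -> h 0%N j = (cnorm (h 0%N j))%:C * expturn (L0 j).
  elim: j => [_|j IH jM]; first exact: (angP _).1.
  by apply: step; [exact: h0 (ltnW jM)|exact: IH (ltnW jM)].
have hL i j : (i <= N)%N -> (j <= M)%N ->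
    h i j = (cnorm (h i j))%:C * expturn (L i j).
  elim: i => [_|i IH iN] jM; first exact: hL0.
  by apply: step; [exact: h0 (ltnW iN) jM|exact: IH (ltnW iN) jM].
have Lh i j : (i < N)%N -> (j <= M)%N -> `|L i.+1 j - L i j| < 4^-1.
  by move=> iN jM; rewrite /= addrC addKr; apply: (angP _).2; exact: hh.
exists L; split=> //.
elim=> [|i IH] j iN jM.
  by rewrite /= addrC addKr; apply: (angP _).2; exact: hv.
have V := IH j (ltnW iN) jM.
have H1 := Lh i j iN (ltnW jM); have H2 := Lh i j.+1 iN jM.
set v := ang (h i.+1 j.+1 / h i.+1 j).
have v4 : `|v| < 4^-1 by apply: (angP _).2; exact: hv.
have [w0 w0'] := (h0 i.+1 j iN (ltnW jM), h0 i.+1 j.+1 iN jM).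
have /expturn_inj : expturn (L i.+1 j.+1) = expturn (L i.+1 j + v).
  have := step _ (h i.+1 j.+1) _ w0 (hL i.+1 j iN (ltnW jM)).
  rewrite {1}(hL i.+1 j.+1 iN jM); apply: mulfI.
  by rewrite fmorph_eq0 cnorm_eq0.
move=> mI; have e0 : L i.+1 j.+1 - (L i.+1 j + v) = 0.
  apply: int_lt1_eq0 mI _.
  by move: H1 H2 V v4; rewrite -/v !ltr_norml; lra.
by rewrite (_ : L i.+1 j.+1 - L i.+1 j = v)//; lra.
Qed.

(** The integer cannot jump: a neighbouring lift is within 1/4 + 1/2 of the old centre and within
    1/4 of its own, so the two centres differ by less than 1. *)
Lemma side_lift (f : nat -> R[i]) (L : nat -> R) (N : nat) (a : R) :
  (forall k, (k <= N)%N -> f k = (cnorm (f k))%:C * expturn (L k)) ->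
  (forall k, (k < N)%N -> `|L k.+1 - L k| < 2^-1) ->
  (forall k, (k <= N)%N -> 0 < dircomp a (f k)) ->
  exists m : int, forall k, (k <= N)%N -> `|L k - a - m%:~R| < 4^-1.
Proof.
move=> fL dL fa.
have near k : (k <= N)%N -> exists m : int, `|L k - a - m%:~R| < 4^-1.
  move=> kN; apply: (@dircomp_gt0_near _ a (L k) (cnorm (f k))) (cnorm_ge0 _).
  by rewrite -fL// fa.
have [m mP] := near 0%N isT; exists m.
elim=> [//|k IH] kN; have [m' m'P] := near k.+1 kN.
suff -> : m = m' by [].
apply: (@int_near_eq _ _ (L k - a) (IH (ltnW kN))).
by move: (dL k kN) m'P; rewrite !ltr_norml; lra.
Qed.

(** By compactness it is enough to work near one point. There both values are within a third of |H u
    v| of [H u v], so their difference is smaller than the modulus of the denominator and the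
    quotient has positive real part. *)
Lemma unit_square_uniform (H : R -> R -> R[i]) :
  (forall u v, 0 <= u <= 1 -> 0 <= v <= 1 ->
     {for (u, v), continuous (fun x : R * R => H x.1 x.2)}) ->
  (forall u v, 0 <= u <= 1 -> 0 <= v <= 1 -> H u v != 0) ->
  exists2 e : R, 0 < e & forall u v u' v', 0 <= u <= 1 -> 0 <= v <= 1 ->
    0 <= u' <= 1 -> 0 <= v' <= 1 -> `|u - u'| < e -> `|v - v'| < e ->
    0 < complex.Re (H u' v' / H u v).
Proof.
move=> Hc H0.
pose K : set (R * R) := `[0, 1]%classic `*` `[0, 1]%classic.
have /compact_near_coveringP cK : compact K.
  by apply: compact_setX; exact: segment_compact.
pose P (e : R) (x : R * R) := forall u' v', 0 <= u' <= 1 -> 0 <= v' <= 1 ->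
   `|x.1 - u'| < e -> `|x.2 - v'| < e -> 0 < complex.Re (H u' v' / H x.1 x.2).
have : \forall e \near 0^'+, K `<=` P e.
  apply: cK => -[u v] []; rewrite /= !in_itv/= => u01 v01.
  have w0 : 0 < cnorm (H u v) by rewrite cnorm_gt0 H0.
  have : \forall x \near (u, v), cnorm (H u v - H x.1 x.2) < cnorm (H u v) / 3.
    by apply: (cvgC _ _).1 (Hc u v u01 v01) _ _; rewrite divr_gt0.
  case/nbhs_ballP => r /= r0 rP.
  near=> x e => u' v' u01' v01' /= xu xv.
  have [xr1 xr2] : ball (u, v) (r / 2) x.
    by near: x; apply: nbhsx_ballx; rewrite divr_gt0.
  have er : e <= r / 2 by near: e; apply: nbhs_right_le; rewrite divr_gt0.
  rewrite /ball/= in xr1 xr2.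
  have h1 : cnorm (H u v - H x.1 x.2) < cnorm (H u v) / 3.
    by apply: rP; split; rewrite /ball/=; lra.
  have h2 : cnorm (H u v - H u' v') < cnorm (H u v) / 3.
    apply: (rP (u', v')); split; rewrite /ball/=.
      by rewrite (le_lt_trans (ler_distD x.1 _ _))//; lra.
    by rewrite (le_lt_trans (ler_distD x.2 _ _))//; lra.
  have x0 : 2 / 3 * cnorm (H u v) < cnorm (H x.1 x.2).
    by have := ler_cnormB (H u v) (H x.1 x.2); have := cnormB (H u v) (H x.1 x.2); lra.
  have xn0 : H x.1 x.2 != 0 by rewrite -cnorm_gt0 (lt_trans _ x0)// mulr_gt0.
  have d1 : cnorm (H x.1 x.2 - H u' v') < cnorm (H x.1 x.2).
    have := ler_cnormD (H x.1 x.2 - H u v) (H u v - H u' v').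
    rewrite addrA subrK (cnormB (H x.1 x.2) (H u v)); lra.
  have -> : H u' v' / H x.1 x.2 = 1 - (H x.1 x.2 - H u' v') / H x.1 x.2.
    by rewrite mulrBl divff// subKr.
  have := ler_norm_Re ((H x.1 x.2 - H u' v') / H x.1 x.2).
  rewrite raddfB/= subr_gt0 cnormM cnormV => h.
  apply: le_lt_trans (ler_norm _) _; apply: le_lt_trans h _.
  by rewrite ltr_pdivrMr ?mul1r// cnorm_gt0.
move=> h.
have [e [e0 eP]] : exists e : R, 0 < e /\ K `<=` P e.
  near (0:R)^'+ => e; exists e; split; first by near: e; exact: nbhs_right_gt.
  by near: e.
exists e => // u v u' v' u01 v01 u01' v01' uu vv.
by apply: (eP (u, v)) => //; split; rewrite /= in_itv.
Unshelve. all: by end_near.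
Qed.

Definition continuous_on_square (H : R -> R -> R[i]) :=
  forall u v, 0 <= u <= 1 -> 0 <= v <= 1 ->
     {for (u, v), continuous (fun x : R * R => H x.1 x.2)}.

Lemma square_lift (H : R -> R -> R[i]) : continuous_on_square H ->
  (forall u v, 0 <= u <= 1 -> 0 <= v <= 1 -> H u v != 0) ->
  exists (N : nat) (L : nat -> nat -> R), (4 <= N)%N /\
  let x (k : nat) : R := k%:R / N%:R in
  [/\ forall i j, (i <= N)%N -> (j <= N)%N ->
        H (x i) (x j) = (cnorm (H (x i) (x j)))%:C * expturn (L i j),
      forall i j, (i < N)%N -> (j <= N)%N -> `|L i.+1 j - L i j| < 4^-1
    & forall i j, (i <= N)%N -> (j < N)%N -> `|L i j.+1 - L i j| < 4^-1].
Proof.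
move=> Hc H0; have [e e0 eP] := unit_square_uniform Hc H0.
(* The summand 4 gives 1/N <= 1/4, used when the angle v itself is subtracted along a side in
   [square_zero_degree]. *)
pose N := (Num.bound e^-1).+4; have N0 : 0 < N%:R :> R by rewrite ltr0n.
pose x (k : nat) : R := k%:R / N%:R.
have x01 k : (k <= N)%N -> 0 <= x k <= 1.
  by move=> kN; rewrite divr_ge0//= ler_pdivrMr// mul1r ler_nat.
have xS k : `|x k - x k.+1| < e.
  rewrite distrC -mulrBl -natr1 addrAC subrr add0r ger0_norm ?divr_ge0//.
  rewrite ltr_pdivrMr// -ltr_pdivrMl// mulr1.
  apply: lt_trans (_ : (Num.bound e^-1)%:R < _); last by rewrite ltr_nat /N; lia.
  by rewrite archi_boundP// invr_ge0 ltW.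
have x0 k : `|x k - x k| < e by rewrite subrr normr0.
have [L [L1 L2 L3]] : exists L : nat -> nat -> R,
  [/\ forall i j, (i <= N)%N -> (j <= N)%N ->
        H (x i) (x j) = (cnorm (H (x i) (x j)))%:C * expturn (L i j),
      forall i j, (i < N)%N -> (j <= N)%N -> `|L i.+1 j - L i j| < 4^-1
    & forall i j, (i <= N)%N -> (j < N)%N -> `|L i j.+1 - L i j| < 4^-1].
  apply: (@grid_lift (fun i j => H (x i) (x j)) N N) => i j iN jN.
  - by rewrite H0// x01.
  - by apply: eP => //; rewrite x01// ltnW.
  - by apply: eP => //; rewrite x01// ltnW.
by exists N, L; split=> //; rewrite /N; lia.
Qed.

(** Without a zero the argument lifts to the grid and stays, along each side, within a quarter turn
    of an integer translate of a, b, c + 1/2 or e + 1/2. The corners then force mA - mC = 1, mB - mC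
    = 0, mB - mE = 1 and mA - mE = 1, which are incompatible: the winding number of the boundary is
    not 0. *)
Lemma square_zero_crossing (H : R -> R -> R[i]) (a b c e : R) :
  continuous_on_square H -> a < c < b -> b < e < a + 1 ->
  (forall v, 0 <= v <= 1 -> 0 < dircomp a (H 0 v)) ->
  (forall v, 0 <= v <= 1 -> 0 < dircomp b (H 1 v)) ->
  (forall u, 0 <= u <= 1 -> 0 < dircomp (c + 2^-1) (H u 0)) ->
  (forall u, 0 <= u <= 1 -> 0 < dircomp (e + 2^-1) (H u 1)) ->
  exists u v, [/\ 0 <= u <= 1, 0 <= v <= 1 & H u v = 0].
Proof.
move=> Hc /andP[ac cb] /andP[be ea] Ha Hb Hcc He.
apply: contrapT => nz.
have H0 u v : 0 <= u <= 1 -> 0 <= v <= 1 -> H u v != 0.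
  by move=> u1 v1; apply/eqP => h; apply: nz; exists u, v.
have [N [L [N4 [L1 L2 L3]]]] := square_lift Hc H0.
pose x (k : nat) : R := k%:R / N%:R.
have N0 : 0 < N%:R :> R by rewrite ltr0n; lia.
have x0 : x 0%N = 0 by rewrite /x mul0r.
have x1 : x N = 1 by rewrite /x divff// gt_eqF.
have x01 k : (k <= N)%N -> 0 <= x k <= 1.
  by move=> kN; rewrite divr_ge0//= ler_pdivrMr// mul1r ler_nat.
have w (r : R) : r < 4^-1 -> r < 2^-1 by lra.
have [||k kN|mA hA] := @side_lift (fun j => H (x 0%N) (x j)) (L 0%N) N a.
- by move=> k kN; exact: L1.
- by move=> k kN; apply/w/L3.
- by rewrite x0; apply/Ha/x01.
have [||k kN|mB hB] := @side_lift (fun j => H (x N) (x j)) (L N) N b.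
- by move=> k kN; exact: L1.
- by move=> k kN; apply/w/L3.
- by rewrite x1; apply/Hb/x01.
have [||k kN|mC hC] := @side_lift (fun j => H (x j) (x 0%N)) (L^~ 0%N) N (c + 2^-1).
- by move=> k kN; exact: L1.
- by move=> k kN; apply/w/L2.
- by rewrite x0; apply/Hcc/x01.
have [||k kN|mE hE] := @side_lift (fun j => H (x j) (x N)) (L^~ N) N (e + 2^-1).
- by move=> k kN; exact: L1.
- by move=> k kN; apply/w/L2.
- by rewrite x1; apply/He/x01.
have := hA 0%N isT; have := hA N (leqnn _); have := hB 0%N isT; have := hB N (leqnn _).
have := hC 0%N isT; have := hC N (leqnn _); have := hE 0%N isT; have := hE N (leqnn _).
move: (L 0%N 0%N) (L 0%N N) (L N 0%N) (L N N) => l00 l0N lN0 lNN.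
rewrite !ltr_norml => h1 h2 h3 h4 h5 h6 h7 h8.
have q (m : int) : -1 < m%:~R :> R -> m%:~R < 1 :> R -> m%:~R = 0 :> R.
  by move=> ? ?; apply: int_lt1_eq0; rewrite ?intr_int//; apply/andP.
have BC : (mB - mC)%:~R = 0 :> R by apply: q; rewrite intrB; lra.
have BE : (mB - mE - 1)%:~R = 0 :> R by apply: q; rewrite !intrB; lra.
have AC : (mA - mC - 1)%:~R = 0 :> R by apply: q; rewrite !intrB; lra.
have AE : (mA - mE - 1)%:~R = 0 :> R by apply: q; rewrite !intrB; lra.
by move: BC BE AC AE; rewrite !intrB; lra.
Qed.

(** The square is an annulus cut open, with [v] as the angle. Without a zero the winding number of
    [H u] would be an integer varying by less than 1 between neighbouring grid circles, yet it is 0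
    for u = 0 and 1 for u = 1. *)
Lemma square_zero_degree (H : R -> R -> R[i]) (a : R) :
  continuous_on_square H -> (forall u, 0 <= u <= 1 -> H u 0 = H u 1) ->
  (forall v, 0 <= v <= 1 -> 0 < dircomp a (H 0 v)) ->
  (forall v, 0 <= v <= 1 -> 0 < dircomp v (H 1 v)) ->
  exists u v, [/\ 0 <= u <= 1, 0 <= v <= 1 & H u v = 0].
Proof.
move=> Hc Hper Ha Hv.
apply: contrapT => nz.
have H0 u v : 0 <= u <= 1 -> 0 <= v <= 1 -> H u v != 0.
  by move=> u1 v1; apply/eqP => h; apply: nz; exists u, v.
have [N [L [N4 [L1 L2 L3]]]] := square_lift Hc H0.
pose x (k : nat) : R := k%:R / N%:R.
have N0 : 0 < N%:R :> R by rewrite ltr0n; lia.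
have x0 : x 0%N = 0 by rewrite /x mul0r.
have x1 : x N = 1 by rewrite /x divff// gt_eqF.
have x01 k : (k <= N)%N -> 0 <= x k <= 1.
  by move=> kN; rewrite divr_ge0//= ler_pdivrMr// mul1r ler_nat.
have w (r : R) : r < 4^-1 -> r < 2^-1 by lra.
have [||k kN|mA hA] := @side_lift (fun j => H (x 0%N) (x j)) (L 0%N) N a.
- by move=> k kN; exact: L1.
- by move=> k kN; apply/w/L3.
- by rewrite x0; apply/Ha/x01.
have [||k kN|mB hB] := @side_lift (fun j => H (x N) (x j) * expturn (- x j))
    (fun j => L N j - x j) N 0.
- by move=> k kN; rewrite {1}L1// cnormM cnorm_expturn mulr1 expturnD mulrA.
- move=> k kN; have := L3 N k (leqnn _) kN.
  have -> : x k.+1 = x k + N%:R^-1 by rewrite /x -natr1 mulrDl mul1r.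
  have : N%:R^-1 <= 4^-1 :> R by rewrite lef_pV2 ?posrE// ler_nat.
  have : 0 < N%:R^-1 :> R by rewrite invr_gt0.
  by rewrite !ltr_norml; lra.
- by rewrite /dircomp oppr0 expturn0 mulr1 x1; apply/Hv/x01.
have per i : (i <= N)%N -> L i N - L i 0%N \is a Num.int.
  move=> iN; apply: expturn_inj.
  have E0 : H (x i) 0 = (cnorm (H (x i) 0))%:C * expturn (L i 0%N).
    by have := L1 i 0%N iN isT; rewrite mul0r.
  have E1 : H (x i) 1 = (cnorm (H (x i) 1))%:C * expturn (L i N).
    by have := L1 i N iN (leqnn _); rewrite divff ?gt_eqF.
  have n0 : (cnorm (H (x i) 0))%:C != 0.
    by rewrite fmorph_eq0 cnorm_eq0 H0 ?x01 ?lexx ?ler01.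
  by apply: (mulfI n0); rewrite -E0 Hper ?x01// -E1.
have per0 i : (i <= N)%N -> L i N - L i 0%N = 0.
  elim: i => [|i IH] iN; apply: int_lt1_eq0 (per _ iN) _.
    by have := hA 0%N isT; have := hA N (leqnn _); rewrite !ltr_norml; lra.
  have := L2 i 0%N iN isT; have := L2 i N iN (leqnn _); have := IH (ltnW iN).
  by rewrite !ltr_norml; lra.
have := per0 N (leqnn _); have := hB 0%N isT; have := hB N (leqnn _).
by rewrite x1 x0 !ltr_norml; lra.
Qed.

End square_lift.

(** * The Boettcher map near infinity *)

Lemma expn_tower_large (R : realType) (r B : R) (d : nat) : (2 <= d)%N -> 1 < r ->
  exists n0, forall n, (n0 <= n)%N -> B < r ^+ (d ^ n).
Proof.
move=> d2 r1; pose h := r - 1; have h0 : 0 < h by rewrite subr_gt0.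
have bern n : n%:R * h <= r ^+ n.
  elim: n => [|n IH]; first by rewrite mul0r expr0 ler01.
  have r1n : 1 <= r ^+ n by rewrite exprn_ege1// ltW.
  have -> : r ^+ n.+1 = r ^+ n + h * r ^+ n by rewrite exprS /h; ring.
  by rewrite -natr1 mulrDl mul1r lerD// ler_peMr// ltW.
exists (Num.bound `|B / h|) => n n0.
have : B / h < n%:R.
  rewrite (le_lt_trans (ler_norm _))// (lt_le_trans (archi_boundP _))//.
  by rewrite ler_nat.
rewrite ltr_pdivrMr// => /lt_le_trans -> //; apply: le_trans (bern n) _.
by apply: ler_weXn2l; [exact: ltW|rewrite ltnW// ltn_expl].
Qed.

Section curves.
Variable R : realType.

Lemma expturn_continuous : continuous (@expturn R).
Proof.
move=> t; apply/cvgC => e e0.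
have c2 : (2 * pi * s) @[s --> t] --> 2 * pi * t.
  by apply: cvgM; [exact: cvg_cst|exact: cvg_id].
have hc : cos (2 * pi * s) @[s --> t] --> cos (2 * pi * t).
  by apply: continuous_cvg c2; exact: continuous_cos.
have hs : sin (2 * pi * s) @[s --> t] --> sin (2 * pi * t).
  by apply: continuous_cvg c2; exact: continuous_sin.
have e2 : 0 < e / 2 by rewrite divr_gt0.
have hc' := (cvgrPdist_lt _ _).1 hc _ e2; have hs' := (cvgrPdist_lt _ _).1 hs _ e2.
near=> s; rewrite cnorm_def.
have h1 : `|cos (2 * pi * t) - cos (2 * pi * s)| < e / 2 by near: s; exact: hc'.
have h2 : `|sin (2 * pi * t) - sin (2 * pi * s)| < e / 2 by near: s; exact: hs'.
rewrite -[ltRHS]ger0_norm 1?ltW// -sqrtr_sqr ltr_sqrt ?exprn_gt0//=.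
rewrite -(real_normK (num_real (cos _ - _))) -(real_normK (num_real (sin _ - _))).
have := normr_ge0 (cos (2 * pi * t) - cos (2 * pi * s)).
have := normr_ge0 (sin (2 * pi * t) - sin (2 * pi * s)).
nra.
Unshelve. all: by end_near.
Qed.

Lemma real_complex_continuous : continuous (fun x : R => x%:C).
Proof.
move=> t; apply/cvgC => e e0.
have h := (cvgrPdist_lt _ _).1 (@cvg_id R (nbhs t)) _ e0.
by near=> s; rewrite -rmorphB/= cnorm_real; near: s; exact: h.
Unshelve. all: by end_near.
Qed.

Lemma antipoly_continuous d (c : R[i]) : continuous (antipoly d c).
Proof.
move=> z; have F := nbhs_filter z.
apply: (@cvgCD R _ _ F (fun w : R[i] => w^* ^+ d) (fun=> c)); last exact: (@cvgC_cst R _ _ F c).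
by apply: (@cvgCX R _ _ F); apply: (@cvgCJ R _ _ F); exact: cvg_id.
Qed.

Lemma iter_continuous (f : R[i] -> R[i]) n : continuous f -> continuous (iter n f).
Proof.
move=> fc; elim: n => [|n IH] z; first exact: cvg_id.
by apply: continuous_cvg (IH z); exact: fc.
Qed.

End curves.

Section bottcher.
Variables (R : realType) (d : nat) (c : R[i]) (U : set R[i]) (rho : R).
Variable phi : R[i] -> R[i].
Hypothesis d2 : (2 <= d)%N.
Let f := antipoly d c.
Hypothesis hphi : bottcher_map d f U rho phi.

Lemma bottcher_near_id (e : R) : 0 < e -> exists2 M : R, 0 < M &
  forall z, M < cnorm z -> U z /\ cnorm (phi z - z) < e * cnorm z.
Proof.
move=> e0; have [M1 U1] := bottcher_nbhs hphi.
have [M2 N2] := bottcher_norm hphi e0.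
exists (1 + `|M1| + `|M2|); first by rewrite -addrA ltr_pwDl// addr_ge0.
move=> z zM; have := ler_norm M1; have := ler_norm M2.
have := normr_ge0 M1; have := normr_ge0 M2 => ? ? ? ?.
split; first by apply: U1; rewrite cnormE ltcR; lra.
have z0 : z != 0 by rewrite -cnorm_gt0; lra.
have := N2 z; rewrite !cnormE !ltcR => /(_ _)/wrap[]; first by lra.
move=> h; have -> : phi z - z = (phi z / z - 1) * z by rewrite mulrBl mul1r divfK.
by rewrite cnormM ltr_pM2r// cnorm_gt0.
Qed.

Lemma bottcher_continuous z : U z -> {for z, continuous phi}.
Proof.
by move=> Uz; apply/differentiable_continuous/derivable1_diffP/(bottcher_holo hphi).
Qed.

(* Winding numbers: on a large circle [phi] is close to the identity, so its
   values outside that circle cover a neighbourhood of infinity; injectivity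
   then keeps every other point of [U] away from that neighbourhood. *)
Lemma bottcher_proper (B : R) : exists B' : R, forall z, U z ->
  B' < cnorm (phi z) -> B < cnorm z.
Proof.
have h2 : 0 < 2^-1 :> R by rewrite invr_gt0 ltr0n.
have [M M0 hM] := bottcher_near_id h2.
pose r0 := 1 + M + `|B|.
have r00 : 0 < r0 by rewrite ltr_pwDl// addr_gt0.
have Mr0 : M < r0 by rewrite /r0; have := normr_ge0 B; lra.
exists (2 * r0) => z1 Uz1 w1; rewrite ltNge; apply/negP => zB.
pose w := phi z1; have [t wt] := polar w.
(* On the inner circle |phi| < 3/2 r0 < |w|, so phi - w points away from w. On the outer one |phi -
   p| < r1/2 and |w| = r1/4, so phi - w follows the angle of p. *)
pose r1 := 4 * cnorm w; have r01 : r0 < r1 by rewrite /r1 /w; lra.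
pose r (u : R) := r0 + u * (r1 - r0).
have r_ge u : 0 <= u <= 1 -> r0 <= r u.
  by move=> /andP[u0 _]; rewrite lerDl mulr_ge0// subr_ge0 ltW.
pose p (u v : R) : R[i] := (r u)%:C * expturn v.
have pn u v : 0 <= u <= 1 -> cnorm (p u v) = r u.
  move=> /r_ge ru; rewrite cnormM cnorm_expturn mulr1 cnorm_real ger0_norm//.
  by apply: le_trans ru; exact: ltW.
have pU u v : 0 <= u <= 1 ->
    U (p u v) /\ cnorm (phi (p u v) - p u v) < 2^-1 * r u.
  move=> u1; have := hM (p u v); rewrite pn//; apply.
  exact: lt_le_trans (r_ge _ u1).
pose H (u v : R) : R[i] := phi (p u v) - w.
have pc : continuous (fun x : R * R => p x.1 x.2).
  move=> x; apply: cvgCM.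
    apply: continuous_cvg; first exact: real_complex_continuous.
    apply: cvgD; [exact: cvg_cst|apply: cvgM; [exact: cvg_fst|exact: cvg_cst]].
  by apply: continuous_cvg; [exact: expturn_continuous|exact: cvg_snd].
have [u [v [u1 v1]]] : exists u v, [/\ 0 <= u <= 1, 0 <= v <= 1 & H u v = 0].
  apply: (@square_zero_degree R H (t + 2^-1)).
  - move=> u v u1 v1; apply: cvgCB; last exact: cvgC_cst.
    apply: continuous_cvg (pc _).
    exact: (bottcher_continuous (pU u v u1).1).
  - move=> u u1; rewrite /H /p (_ : expturn 1 = expturn 0)//.
    by rewrite expturn0 expturn_int// int_num1.
  - move=> v v1; have z01 : 0 <= (0 : R) <= 1 by apply/andP; split.
    have [_ pv] := pU 0 v z01; have pn0 := pn 0 v z01.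
    have wt' : dircomp (t + 2^-1) w = - cnorm w.
      rewrite {1}wt dircomp_polar opprD addNKr mulrN cosN.
      by rewrite [2 * pi]mulrC mulfK ?pnatr_eq0// cospi mulrN1.
    have r0E : r 0 = r0 by rewrite /r mul0r addr0.
    rewrite /H -[phi _](subrK (p 0 v)) !dircompD dircompN wt' opprK.
    have := ler_dircomp (t + 2^-1) (phi (p 0 v) - p 0 v).
    have := ler_dircomp (t + 2^-1) (p 0 v).
    rewrite dircompD !ler_norml pn0 r0E => /andP[? _] /andP[? _].
    by rewrite r0E in pv; rewrite -/w in w1; lra.
  - move=> v v1; have z01 : 0 <= (1 : R) <= 1 by apply/andP; split.
    have [_ pv] := pU 1 v z01.
    have r1E : r 1 = r1 by rewrite /r mul1r addrC subrK.
    have pE : dircomp v (p 1 v) = r1.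
      by rewrite dircomp_polar subrr mulr0 cos0 mulr1 r1E.
    rewrite /H -[phi _](subrK (p 1 v)) !dircompD dircompN pE.
    have := ler_dircomp v (phi (p 1 v) - p 1 v).
    have := ler_dircomp v w.
    rewrite dircompD !ler_norml => /andP[_ ?] /andP[? _].
    by rewrite r1E in pv; rewrite -/w in w1; rewrite /r1 in pv *; lra.
move=> /eqP; rewrite subr_eq0 => /eqP pw.
have /eqP : p u v = z1.
  by apply: (set_bij_inj (bottcher_bij hphi)) pw; rewrite inE//; exact: (pU u v u1).1.
apply/negP; apply: contraTneq zB => <-; rewrite pn// -ltNge.
apply: lt_le_trans (r_ge _ u1); have := ler_norm B; rewrite /r0; lra.
Qed.

End bottcher.

(** * Dynamical rays *)

Section rays.
Variables (R : realType) (d : nat) (c : R[i]) (U : set R[i]) (rho : R).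
Variable phi : R[i] -> R[i].
Hypothesis d2 : (2 <= d)%N.
Let f := antipoly d c.
Hypothesis hphi : bottcher_map d f U rho phi.

(** The difference of the d-th powers factors as (u - v) S, and at [s] the sum [S] equals d
    u(s)^(d-1), which is nonzero away from the critical point. *)
Lemma antipoly_locally_injective (u v : R -> R[i]) (s : R) :
  {for s, continuous u} -> {for s, continuous v} -> u s = v s -> u s != 0 ->
  (\forall r \near s, f (u r) = f (v r)) -> \forall r \near s, u r = v r.
Proof.
move=> uc vc uvs u0 fuv.
pose S r := \sum_(i < d) u r ^+ (d.-1 - i) * v r ^+ i.
have FF := nbhs_filter s.
have Sc : S r @[r --> s] --> \sum_(i < d) u s ^+ (d.-1 - i) * v s ^+ i.
  rewrite /S; move: (d.-1) => m.
  elim: d => [|k IH].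
    rewrite big_ord0 (_ : (fun r => _) = fun=> 0); first exact: (@cvgC_cst R _ _ FF).
    by apply/funext => r; rewrite big_ord0.
  rewrite big_ord_recr/= (_ : (fun r => _) = (fun r => \sum_(i < k) u r ^+ (m - i) * v r ^+ i
      + u r ^+ (m - k) * v r ^+ k)); last by apply/funext => r; rewrite big_ord_recr.
  apply: (@cvgCD R _ _ FF) IH _.
  apply: (@cvgCM R _ _ FF (fun r => u r ^+ (m - k)) (fun r => v r ^+ k)
    (u s ^+ (m - k)) (v s ^+ k)).
    exact: (@cvgCX R _ _ FF u (u s) (m - k) uc).
  exact: (@cvgCX R _ _ FF v (v s) k vc).
have S0 : \sum_(i < d) u s ^+ (d.-1 - i) * v s ^+ i != 0.
  rewrite (eq_bigr (fun=> u s ^+ d.-1)).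
    by rewrite sumr_const card_ord -mulr_natr mulf_neq0 ?expf_neq0// pnatr_eq0; lia.
  move=> i _; rewrite -uvs -exprD subnK//.
  by have := ltn_ord i; lia.
have Sn : \forall r \near s, S r != 0.
  have e0 : 0 < cnorm (\sum_(i < d) u s ^+ (d.-1 - i) * v s ^+ i) by rewrite cnorm_gt0.
  have := (@cvgC R _ _ FF _ _).1 Sc _ e0.
  apply: filterS => r h; apply/negP => /eqP Sr.
  by move: h; rewrite Sr subr0 ltxx.
apply: filterS2 fuv Sn => r /addIr e Sr.
have : (u r - v r) * S r = 0.
  rewrite -subrXX; apply/eqP; rewrite subr_eq0; apply/eqP.
  by apply: (can_inj (@conjcK R)); rewrite !rmorphXn.
by move/eqP; rewrite mulf_eq0 (negbTE Sr) orbF subr_eq0 => /eqP.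
Qed.

Lemma ray_dynamics t gamma r : dynamical_ray d f U rho phi t gamma -> 1 < r ->
  exists n0, forall n, (n0 <= n)%N -> U (iter n f (gamma r)) /\
    phi (iter n f (gamma r)) = (r ^+ (d ^ n))%:C * expturn ((- d%:R) ^+ n * t).
Proof.
move=> [_ h] r1; have [n0 n0P] := expn_tower_large rho d2 r1.
by exists n0 => n nn0; apply: h => //; exact: n0P.
Qed.

(** The Boettcher coordinate of the iterates tends to infinity; [bottcher_proper] transfers this to
    the iterates themselves. *)
Lemma ray_escape t gamma r (B : R) : dynamical_ray d f U rho phi t gamma -> 1 < r ->
  exists n0, forall n, (n0 <= n)%N -> B < cnorm (iter n f (gamma r)).
Proof.
move=> hg r1; have [n0 n0P] := ray_dynamics hg r1.
have [B' B'P] := bottcher_proper hphi B.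
have [n1 n1P] := expn_tower_large B' d2 r1.
exists (maxn n0 n1) => n; rewrite geq_max => /andP[h0 h1].
have [Un pn] := n0P n h0; apply: (B'P _ Un); rewrite pn cnormM cnorm_expturn mulr1.
rewrite cnorm_real ger0_norm ?n1P// exprn_ge0// ltW// (lt_trans ltr01)//.
Qed.

Lemma ray_asymptotic t gamma (e : R) : dynamical_ray d f U rho phi t gamma -> 0 < e ->
  exists r0 : R, forall r, r0 <= r -> cnorm (gamma r - r%:C * expturn t) <= e * r.
Proof.
move=> [_ hg] e0.
(* The bound 1/2 gives |gamma r| <= 2r, and then e/2 turns the relative error at [gamma r] into an
   error of at most e r. *)
pose m := Num.min (e / 2) 2^-1.
have m0 : 0 < m by rewrite lt_min divr_gt0//= invr_gt0 ltr0n.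
have [me m2] : m <= e / 2 /\ m <= 2^-1 by split; rewrite ge_min lexx ?orbT.
have [M M0 hM] := bottcher_near_id hphi m0.
have [B hB] := bottcher_proper hphi M.
exists (2 + `|rho| + `|B|) => r rB.
have := ler_norm rho; have := ler_norm B; have := normr_ge0 rho; have := normr_ge0 B.
move=> B0 rho0 Bn rhon.
have [] := hg 0%N r; rewrite ?expn0 ?expr1 ?expr0 ?mul1r/=; [lra|lra|].
move=> Ug pg.
have Mg : M < cnorm (gamma r).
  apply: (hB _ Ug); rewrite pg cnormM cnorm_expturn mulr1 cnorm_real.
  by apply: lt_le_trans (ler_norm _); lra.
have [_] := hM _ Mg; rewrite pg cnormB => h.
have r0 : 0 < r by lra.
have := ler_cnormB (gamma r) (r%:C * expturn t).
rewrite cnormM cnorm_expturn mulr1 cnorm_real gtr0_norm// => h2.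
have g2 : cnorm (gamma r) <= 2 * r.
  have : m * cnorm (gamma r) <= 2^-1 * cnorm (gamma r).
    by apply: ler_wpM2r => //; exact: cnorm_ge0.
  lra.
have : m * cnorm (gamma r) <= e / 2 * (2 * r).
  by apply: ler_pM; rewrite ?cnorm_ge0// ltW.
lra.
Qed.

(** The curves agree at large radii by injectivity of [phi]. At the supremum [s] of the radii where
    they differ they agree by continuity, and some iterate of them agrees near [s]. As [gamma]
    avoids the preimages of 0, local injectivity pulls this agreement back one iterate at a time to
    the curves themselves, contradicting the choice of [s]. *)
Lemma ray_unique t t' gamma gamma' : t - t' \is a Num.int ->
  dynamical_ray d f U rho phi t gamma -> dynamical_ray d f U rho phi t' gamma' ->
  (forall n r, 1 < r -> iter n f (gamma r) <> 0) ->
  forall r, 1 < r -> gamma r = gamma' r.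
Proof.
move=> tt [gc hg] [gc' hg'] gn0.
have same n r : 1 < r -> rho < r ^+ (d ^ n) ->
    iter n f (gamma r) = iter n f (gamma' r).
  move=> r1 rn; have [Ug pg] := hg n r r1 rn; have [Ug' pg'] := hg' n r r1 rn.
  apply: (set_bij_inj (bottcher_bij hphi)); rewrite ?inE// pg pg'; congr (_ * _).
  have -> : (- d%:R) ^+ n * t = (- d%:R) ^+ n * t' + (- d%:R) ^+ n * (t - t').
    by ring.
  rewrite expturnD [X in _ * X]expturn_int ?mulr1// rpredM// rpredX// rpredN.
  exact: intr_nat.
apply: contrapT => /existsNP[r0 /not_implyP[r01 r0E]].
pose E := [set r : R | 1 < r /\ gamma r <> gamma' r].
have supE : has_sup E.
  split; first by exists r0.
  exists (Num.max 1 rho) => r [r1 rE]; rewrite leNgt; apply/negP.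
  rewrite gt_max => /andP[_ rr]; by apply: rE; apply: (same 0%N).
pose s := sup E.
have s1 : 1 < s by apply: (lt_le_trans r01); apply: sup_ubound => //; exact: supE.2.
have FF := nbhs_filter s.
have gs : {for s, continuous gamma} by apply: gc; rewrite in_itv/= s1.
have gs' : {for s, continuous gamma'} by apply: gc'; rewrite in_itv/= s1.
have right r : s < r -> gamma r = gamma' r.
  move=> sr; apply: contrapT => rE; have : r <= s.
    by apply: sup_ubound; [exact: supE.2|split=> //; exact: lt_trans sr].
  by rewrite leNgt sr.
have sE : gamma s = gamma' s.
  apply/eqP; apply/negPn/negP => ne.
  have e0 : 0 < cnorm (gamma s - gamma' s) / 2 by rewrite divr_gt0// cnorm_gt0 subr_eq0.
  have h := (@cvgC R _ _ FF _ _).1 gs _ e0; have h' := (@cvgC R _ _ FF _ _).1 gs' _ e0.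
  have hh : \forall r \near s, cnorm (gamma s - gamma r) < cnorm (gamma s - gamma' s) / 2 /\
      cnorm (gamma' s - gamma' r) < cnorm (gamma s - gamma' s) / 2 by exact: filterI.
  case/nbhs_ballP: hh => r /= r00 rP.
  have [] := rP (s + r / 2).
    by rewrite /ball/= opprD addNKr normrN gtr0_norm ?divr_gt0// ltr_pdivrMr//
      mulr_natr mulr2n ltrDl.
  rewrite (right (s + r / 2)) ?ltrDl ?divr_gt0// => h1 h2.
  have := ler_cnormD (gamma s - gamma' (s + r / 2)) (gamma' (s + r / 2) - gamma' s).
  by rewrite addrA subrK (cnormB (gamma' _)); lra.
have [n0 n0P] := expn_tower_large rho d2 s1.
have near_n : \forall r \near s, iter n0 f (gamma r) = iter n0 f (gamma' r).
  have h1 : \forall r \near s, 1 < r by exact: lt_nbhsr.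
  have h2 : \forall r \near s, rho < r ^+ (d ^ n0).
    have h := @exprn_continuous R (d ^ n0)%N s.
    have := h _ (lt_nbhsr (n0P n0 (leqnn _))); exact.
  by near=> r; apply: same; near: r.
have near_m m : (m <= n0)%N ->
    \forall r \near s, iter (n0 - m) f (gamma r) = iter (n0 - m) f (gamma' r).
  elim: m => [|m IH] mn; first by rewrite subn0.
  apply: antipoly_locally_injective.
  - by apply: continuous_cvg gs; apply: iter_continuous; exact: antipoly_continuous.
  - by apply: continuous_cvg gs'; apply: iter_continuous; exact: antipoly_continuous.
  - by rewrite sE.
  - by apply/eqP; exact: gn0.
  - have := IH (ltnW mn); rewrite (_ : (n0 - m)%N = (n0 - m.+1).+1)//; lia.
have := near_m n0 (leqnn _); rewrite subnn => /nbhs_ballP[r /= r00 rP].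
have [x [x1 xE] sx] := sup_adherent r00 supE.
have xs : x <= s by apply: sup_ubound; [exact: supE.2|split].
apply: xE; apply: rP; rewrite /ball/= ger0_norm ?subr_ge0//.
by rewrite ltrBlDl -ltrBlDr.
Unshelve. all: by end_near.
Qed.

(** The map raises the radius to the power d, so the image ray at radius [r] comes from radius
    r^(1/d). *)
Lemma ray_image t gamma : dynamical_ray d f U rho phi t gamma ->
  dynamical_ray d f U rho phi (- d%:R * t) (fun r => f (gamma (expR (ln r / d%:R)))).
Proof.
have d0 : 0 < d%:R :> R by rewrite ltr0n ltnW.
move=> [gc hg]; split=> [r|n r r1 rn].
  rewrite in_itv/= andbT => r1; pose q (x : R) := expR (ln x / d%:R).
  have qc : q x @[x --> r] --> q r.
    apply: (@continuous_cvg _ _ _ _ _ (fun x => ln x / d%:R) (@expR R)).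
    exact: continuous_expR.
    apply: cvgM; last exact: cvg_cst.
    by apply: continuous_ln; exact: lt_trans r1.
  have gq : {for q r, continuous gamma}.
    by apply: gc; rewrite in_itv/= andbT -expR0 ltr_expR divr_gt0// ln_gt0.
  apply: (@continuous_comp _ _ _ (gamma \o q) f); last exact: antipoly_continuous.
  exact: (@continuous_comp _ _ _ q gamma).
have r0 : 0 < r := lt_trans ltr01 r1.
set s := expR _.
have s1 : 1 < s by rewrite -expR0 ltr_expR divr_gt0// ln_gt0.
have sd : s ^+ d = r.
  by rewrite /s -expRM_natl mulrC divfK ?gt_eqF// lnK// posrE.
have sr : s ^+ (d ^ n.+1) = r ^+ (d ^ n) by rewrite expnS exprM sd.
have := hg n.+1 s s1; rewrite sr => /(_ rn) [h1 h2].
by rewrite -iterSr; split=> //; rewrite h2 exprSr mulrA.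
Qed.

Lemma ray_image_cvg (gamma : R -> R[i]) z : gamma r @[r --> 1^'+] --> z ->
  f (gamma (expR (ln r / d%:R))) @[r --> 1^'+] --> f z.
Proof.
move=> gz; apply: (@continuous_cvg _ _ _ _ _ (fun r => gamma (expR (ln r / d%:R))) f).
  exact: antipoly_continuous.
apply: (cvg_comp _ _ _ gz) => P P1.
have sc : expR (ln r / d%:R) @[r --> (1 : R)] --> (1 : R).
  rewrite -[X in _ --> X]expR0 -(mul0r d%:R^-1) -ln1.
  apply: (@continuous_cvg _ _ _ _ _ (fun x => ln x / d%:R) (@expR R)).
    exact: continuous_expR.
  by apply: cvgM; [exact: continuous_ln|exact: cvg_cst].
move: (sc _ P1); apply: (@filterS _ (nbhs (1 : R)) (nbhs_filter (1 : R))) => r h r1; apply: h.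
have d0 : 0 < d%:R :> R by rewrite ltr0n ltnW.
by rewrite -[ltLHS]expR0 ltr_expR divr_gt0// ln_gt0.
Qed.

End rays.

(** * Paths with linked ends meet *)

(** At both ends the parameter is asymptotic to the modulus, so two such paths can be compared on
    one interval [-T, T]. *)
Record proper_path (R : realType) (P : R -> R[i]) (a b : R) : Prop := ProperPath {
  path_continuous : continuous P ;
  path_left : forall e : R, 0 < e -> exists r0 : R, forall r, r0 <= r ->
    cnorm (P (- r) - r%:C * expturn a) <= e * r ;
  path_right : forall e : R, 0 < e -> exists r0 : R, forall r, r0 <= r ->
    cnorm (P r - r%:C * expturn b) <= e * r }.

Section proper_path.
Variable R : realType.
Implicit Types (P Q : R -> R[i]).

Lemma path_bounded P (T : R) : continuous P ->
  exists B : R, forall r, - T <= r <= T -> cnorm (P r) <= B.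
Proof.
move=> Pc; have [T0|T0] := leP (- T) T; last first.
  by exists 0 => r /andP[h1 h2]; have := le_trans h1 h2; rewrite leNgt T0.
have nc : continuous (fun r => cnorm (P r)).
  move=> r; apply/cvgrPdist_lt => e e0.
  have h := (@cvgC R _ _ (nbhs_filter r) _ _).1 (Pc r) _ e0.
  near=> s; have hs : cnorm (P r - P s) < e by near: s; exact: h.
  rewrite ltr_norml; have := ler_cnormB (P r) (P s); have := ler_cnormB (P s) (P r).
  by rewrite (cnormB (P s)); lra.
have [m _ mP] := EVT_max T0 (continuous_subspaceT nc).
by exists (cnorm (P m)) => r rT; apply: mP; rewrite in_itv.
Unshelve. all: by end_near.
Qed.

Lemma cos_turn_lt1 (x : R) : 0 < x < 1 -> cos (2 * pi * x) < 1.
Proof.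
move=> /andP[x0 x1]; rewrite lt_neqAle cos_le1 andbT; apply/eqP => c1.
have : expturn x = 1.
  have := cos2Dsin2 (2 * pi * x); rewrite c1 expr1n => cs.
  have /eqP : sin (2 * pi * x) ^+ 2 = 0 by lra.
  rewrite sqrf_eq0 => /eqP s0.
  by rewrite /expturn c1 s0.
move=> /expturn_eq1/intrP[m xm]; move: x0 x1.
rewrite xm (ltr_int _ 0) (ltr_int _ _ 1); lia.
Qed.

(** Near the point r e(a) the component along [a] is about r, whereas on [-r, r] the path [Q] has
    component at most about k r with k < 1, its end directions being different from [a]. The margin
    1 - k is shared out by [eps]; the bounded middle part of [Q] is outweighed once r >= T +
    2|B|. *)
Lemma path_dominated Q (c e a : R) : proper_path Q c e ->
  cos (2 * pi * (c - a)) < 1 -> cos (2 * pi * (e - a)) < 1 ->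
  exists2 eps : R, 0 < eps & exists r0 : R, forall r, r0 <= r ->
    forall w, cnorm (w - r%:C * expturn a) <= eps * r ->
    forall s, - r <= s <= r -> 0 < dircomp a (w - Q s).
Proof.
move=> [Qc Ql Qr] hc he.
pose k := Num.max 0 (Num.max (cos (2 * pi * (c - a))) (cos (2 * pi * (e - a)))).
have k1 : k < 1 by rewrite !gt_max ltr01 hc he.
have k0 : 0 <= k by rewrite le_max lexx.
have kc : cos (2 * pi * (c - a)) <= k by rewrite !le_max lexx !orbT.
have ke : cos (2 * pi * (e - a)) <= k by rewrite !le_max lexx !orbT.
pose eps := (1 - k) / 4; have e0 : 0 < eps by rewrite divr_gt0// subr_gt0.
have [r1 h1] := Ql _ e0; have [r2 h2] := Qr _ e0.
pose T := 1 + `|r1| + `|r2|; have [B hB] := @path_bounded Q T Qc.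
have r1T : r1 <= T by have := ler_norm r1; have := normr_ge0 r2; rewrite /T; lra.
have r2T : r2 <= T by have := ler_norm r2; have := normr_ge0 r1; rewrite /T; lra.
have T1 : 1 <= T by have := normr_ge0 r1; have := normr_ge0 r2; rewrite /T; lra.
exists eps => //; exists (T + 2 * `|B|) => r rT w wr s /andP[s1 s2].
have B0 := normr_ge0 B; have BB := ler_norm B.
have wa : r - eps * r <= dircomp a w.
  rewrite -[w](subrK (r%:C * expturn a)) dircompD dircomp_polar subrr mulr0 cos0 mulr1.
  have := ler_dircomp a (w - r%:C * expturn a); rewrite ler_norml => /andP[h _].
  lra.
rewrite dircompD dircompN subr_gt0; apply: lt_le_trans wa.
have re : eps * r <= 4^-1 * r by apply: ler_wpM2r; rewrite /eps; lra.
have polar_bound t y (x : R) : cos (2 * pi * (t - a)) <= k -> 0 <= x <= r ->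
    cnorm (y - x%:C * expturn t) <= eps * x -> dircomp a y < r - eps * r.
  move=> ct /andP[x0 xr] yx.
  rewrite -[y](subrK (x%:C * expturn t)) dircompD dircomp_polar.
  have := ler_dircomp a (y - x%:C * expturn t); rewrite ler_norml => /andP[_ h].
  have xc : x * cos (2 * pi * (t - a)) <= x * k by exact: ler_wpM2l.
  have xk : x * k <= r * k by exact: ler_wpM2r.
  have xe : eps * x <= eps * r by apply: ler_wpM2l => //; exact: ltW.
  have ke4 : r * k = r - 4 * (eps * r) by rewrite /eps; field.
  have er0 : 0 < eps * r by rewrite mulr_gt0//; lra.
  lra.
have [sT|sT] := leP T s.
  by apply: (polar_bound e (Q s) s ke); [apply/andP; split; lra|apply: h2; lra].
have [sT'|sT'] := leP s (- T).
  apply: (polar_bound c (Q s) (- s) kc); first by apply/andP; split; lra.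
  by rewrite -{1}[s]opprK; apply: h1; lra.
have := hB s; rewrite (ltW sT) (ltW sT') => /(_ isT) Qs.
apply: le_lt_trans (ler_norm _) _; apply: le_lt_trans (ler_dircomp _ _) _.
lra.
Qed.

(** The zero is sought for the difference P - Q on a large square of parameters. On a side where [P]
    is at an end, that end dominates and gives the direction a or b; where [Q] is at an end, the
    difference points in the opposite direction, c or e plus half a turn. *)
Lemma linked_paths_meet P Q (a b c e : R) : a < c < b -> b < e < a + 1 ->
  proper_path P a b -> proper_path Q c e -> exists u v, P u = Q v.
Proof.
move=> /andP[ac cb] /andP[be ea] hP hQ.
have cosC (x y : R) : 0 < x - y < 1 -> cos (2 * pi * (x - y)) < 1 /\ cos (2 * pi * (y - x)) < 1.
  move=> xy; split; first exact: cos_turn_lt1.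
  rewrite (_ : 2 * pi * (y - x) = - (2 * pi * (x - y))); last by ring.
  by rewrite cosN; exact: cos_turn_lt1.
have [|ca1 ca2] := cosC c a; first by apply/andP; split; lra.
have [|bc1 bc2] := cosC b c; first by apply/andP; split; lra.
have [|eb1 eb2] := cosC e b; first by apply/andP; split; lra.
have [|ea1 ea2] := cosC e a; first by apply/andP; split; lra.
have [ea0 ea0' [ra hra]] := path_dominated hQ ca1 ea1.
have [eb0 eb0' [rb hrb]] := path_dominated hQ bc2 eb1.
have [ec0 ec0' [rc hrc]] := path_dominated hP ca2 bc1.
have [ee0 ee0' [re hre]] := path_dominated hP ea2 eb2.
have [ra' hra'] := path_left hP ea0'; have [rb' hrb'] := path_right hP eb0'.
have [rc' hrc'] := path_left hQ ec0'; have [re' hre'] := path_right hQ ee0'.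
pose T := \big[Num.max/0]_(r <- [:: ra; ra'; rb; rb'; rc; rc'; re; re']) r.
have hT r : r \in [:: ra; ra'; rb; rb'; rc; rc'; re; re'] -> r <= T.
  by move=> rs; rewrite /T; exact: le_bigmax_seq.
have T0 : 0 <= T by exact: bigmax_ge_id.
pose l (x : R) := T * (2 * x - 1).
have l01 x : 0 <= x <= 1 -> - T <= l x <= T.
  move=> /andP[x0 x1]; have : T * x <= T * 1 by exact: ler_wpM2l.
  have : 0 <= T * x by rewrite mulr_ge0.
  by rewrite /l; lra.
have l0 : l 0 = - T by rewrite /l; ring.
have l1 : l 1 = T by rewrite /l; ring.
have lc : continuous l.
  move=> x; apply: cvgM; first exact: cvg_cst.
  by apply: cvgB; [apply: cvgM; [exact: cvg_cst|exact: cvg_id]|exact: cvg_cst].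
pose H (x y : R) : R[i] := P (l x) - Q (l y).
have [[Pc _ _] [Qc _ _]] := (hP, hQ).
have half t w : dircomp (t + 2^-1) w = dircomp t (- w).
  rewrite /dircomp opprD expturnD mulrA mulNr raddfN/=.
  rewrite (_ : expturn (- 2^-1) = -1) ?mulrN1 ?raddfN//.
  rewrite /expturn (_ : 2 * pi * - 2^-1 = - pi); last by field.
  by rewrite cosN sinN cospi sinpi oppr0; apply/eqP; rewrite eq_complex/= oppr0 !eqxx.
have [x [y [x01 y01 xy]]] : exists x y, [/\ 0 <= x <= 1, 0 <= y <= 1 & H x y = 0].
  apply: (@square_zero_crossing R H a b c e).
  - move=> x y _ _; have FF := nbhs_filter (x, y).
    apply: (@cvgCB R _ _ FF (fun z => P (l z.1)) (fun z => Q (l z.2))).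
      apply: (@continuous_cvg _ _ _ _ FF (fun z => l z.1) P).
        exact: Pc.
      by apply: (@continuous_cvg _ _ _ _ FF fst l); [exact: lc|exact: cvg_fst].
    apply: (@continuous_cvg _ _ _ _ FF (fun z => l z.2) Q).
      exact: Qc.
    by apply: (@continuous_cvg _ _ _ _ FF snd l); [exact: lc|exact: cvg_snd].
  - by rewrite ac.
  - by rewrite be.
  - by move=> y /l01 y01; rewrite /H l0; apply: (hra T) => //; [|apply: hra'];
      apply: hT; rewrite !inE eqxx ?orbT.
  - by move=> y /l01 y01; rewrite /H l1; apply: (hrb T) => //; [|apply: hrb'];
      apply: hT; rewrite !inE eqxx ?orbT.
  - by move=> y /l01 y01; rewrite /H l0 half opprB; apply: (hrc T) => //; [|apply: hrc'];
      apply: hT; rewrite !inE eqxx ?orbT.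
  - by move=> y /l01 y01; rewrite /H l1 half opprB; apply: (hre T) => //; [|apply: hre'];
      apply: hT; rewrite !inE eqxx ?orbT.
by exists (l x), (l y); apply/eqP; rewrite -subr_eq0; apply/eqP.
Qed.

End proper_path.

(** * Landing rays *)

Section joined_rays.
Variable R : realType.

Definition joined_rays (g g' : R -> R[i]) (z : R[i]) (u : R) : R[i] :=
  if 0 < u then g' (1 + u) else if u < 0 then g (1 - u) else z.

Lemma joined_rays_gt0 g g' z u : 0 < u -> joined_rays g g' z u = g' (1 + u).
Proof. by rewrite /joined_rays => ->. Qed.

Lemma joined_rays_lt0 g g' z u : u < 0 -> joined_rays g g' z u = g (1 - u).
Proof. by move=> u0; rewrite /joined_rays ltNge (ltW u0)/= u0. Qed.

Lemma joined_rays0 g g' z : joined_rays g g' z 0 = z.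
Proof. by rewrite /joined_rays ltxx. Qed.

Lemma joined_rays_continuous (g g' : R -> R[i]) (z : R[i]) :
  {in `]1, +oo[, continuous g} -> {in `]1, +oo[, continuous g'} ->
  g r @[r --> 1^'+] --> z -> g' r @[r --> 1^'+] --> z ->
  continuous (joined_rays g g' z).
Proof.
move=> gc gc' gz gz' u; have FF := nbhs_filter u.
have addc (v : R) : 1 + x @[x --> v] --> 1 + v.
  by apply: cvgD; [exact: cvg_cst|exact: cvg_id].
have subc (v : R) : 1 - x @[x --> v] --> 1 - v.
  by apply: cvgB; [exact: cvg_cst|exact: cvg_id].
apply/(@cvgC R _ _ FF) => e e0.
case: (ltgtP 0 u) => u0.
- rewrite (joined_rays_gt0 _ _ _ u0).
  have gu : {for 1 + u, continuous g'}.
    by apply: gc'; rewrite in_itv/= andbT ltrDl.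
  have h2 := (@cvgC R _ _ (nbhs_filter (1 + u)) _ _).1 gu _ e0.
  apply: (@filterS2 _ _ FF) (lt_nbhsr u0) (addc u _ h2) => x x0.
  by rewrite joined_rays_gt0.
- rewrite (joined_rays_lt0 _ _ _ u0).
  have gu : {for 1 - u, continuous g}.
    by apply: gc; rewrite in_itv/= andbT ltrDl oppr_gt0.
  have h2 := (@cvgC R _ _ (nbhs_filter (1 - u)) _ _).1 gu _ e0.
  apply: (@filterS2 _ _ FF) (lt_nbhsl u0) (subc u _ h2) => x x0.
  by rewrite joined_rays_lt0.
- rewrite -u0 joined_rays0.
  have h1 := (@cvgC R _ _ (at_right_proper_filter 1) _ _).1 gz _ e0.
  have h2 := (@cvgC R _ _ (at_right_proper_filter 1) _ _).1 gz' _ e0.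
  have := addc 0; rewrite addr0 => /(_ _ h2) h3.
  have := subc 0; rewrite subr0 => /(_ _ h1) h4.
  apply: (@filterS2 _ _ (nbhs_filter (0 : R))) h3 h4 => x a3 a4.
  have [x0|x0|x0] := ltgtP 0 x.
  + by rewrite joined_rays_gt0//; apply: a3; rewrite ltrDl.
  + by rewrite joined_rays_lt0//; apply: a4; rewrite ltrDl oppr_gt0.
  + by rewrite -x0 joined_rays0 subrr cnorm0.
Qed.

End joined_rays.

Section landing.
Variables (R : realType) (d : nat) (c : R[i]) (U : set R[i]) (rho : R).
Variable phi : R[i] -> R[i].
Hypothesis d2 : (2 <= d)%N.
Notation f := (antipoly d c).
Hypothesis hphi : bottcher_map d f U rho phi.

Definition landing_ray (t : R) (z : R[i]) (gamma : R -> R[i]) : Prop :=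
  [/\ dynamical_ray d f U rho phi t gamma,
      forall (n : nat) (r : R), 1 < r -> iter n f (gamma r) <> 0
    & gamma r @[r --> 1^'+] --> z].

Definition landing (t : R) (z : R[i]) : Prop :=
  periodic_angle d t /\ exists gamma, landing_ray t z gamma.

Lemma expN_int (n : nat) (x : R) : x \is a Num.int -> (- d%:R) ^+ n * x \is a Num.int.
Proof. by move=> xi; rewrite rpredM// rpredX// rpredN intr_nat. Qed.

Lemma periodic_angle_int (t t' : R) : t - t' \is a Num.int ->
  periodic_angle d t -> periodic_angle d t'.
Proof.
move=> tt [k k0 kt]; exists k => //.
apply: int_congr (rpredD (rpredB kt (expN_int k tt)) tt); ring.
Qed.

Lemma periodic_angle_image (t : R) : periodic_angle d t -> periodic_angle d (- d%:R * t).
Proof.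
move=> [k k0 kt]; exists k => //.
have h : - d%:R * ((- d%:R) ^+ k * t - t) \is a Num.int.
  by rewrite -[- d%:R]expr1; exact: expN_int.
by apply: int_congr h; ring.
Qed.

(** Multiplication by [-d] is injective on periodic angles: pushing on to a common period N >= n
    brings both angles back to themselves. *)
Lemma periodic_angle_expand_inj (t t' : R) (n : nat) :
  periodic_angle d t -> periodic_angle d t' ->
  (- d%:R) ^+ n * (t - t') \is a Num.int -> t - t' \is a Num.int.
Proof.
move=> [k k0 kt] [k' k0' kt'] h.
have iter_int (x : R) (l m : nat) : (- d%:R) ^+ l * x - x \is a Num.int ->
    (- d%:R) ^+ (l * m) * x - x \is a Num.int.
  move=> hx; elim: m => [|m IH]; first by rewrite muln0 expr0 mul1r subrr rpred0.
  rewrite mulnS exprD.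
  by apply: int_congr (rpredD (expN_int l IH) hx); ring.
pose N := (k * k' * n)%N.
have h1 : (- d%:R) ^+ N * t - t \is a Num.int.
  by rewrite /N -mulnA; exact: iter_int.
have h2 : (- d%:R) ^+ N * t' - t' \is a Num.int.
  by rewrite /N (mulnC k) -mulnA; exact: iter_int.
have h3 : (- d%:R) ^+ N * (t - t') \is a Num.int.
  have -> : N = ((N - n) + n)%N by rewrite subnK// /N leq_pmull// muln_gt0 k0 k0'.
  by rewrite exprD -mulrA; exact: expN_int.
by apply: int_congr (rpredB h3 (rpredB h1 h2)); ring.
Qed.

Lemma landing_ray_int (t t' : R) z gamma : t - t' \is a Num.int ->
  landing_ray t z gamma -> landing_ray t' z gamma.
Proof.
move=> tt [[gc hg] g0 gz]; split=> //; split=> // n r r1 rn.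
have [h1 h2] := hg n r r1 rn; split=> //; rewrite h2; congr (_ * _).
have -> : (- d%:R) ^+ n * t = (- d%:R) ^+ n * t' + (- d%:R) ^+ n * (t - t') by ring.
by rewrite expturnD [X in _ * X]expturn_int ?mulr1// expN_int.
Qed.

Lemma landing_int (t t' : R) z : t - t' \is a Num.int -> landing t z -> landing t' z.
Proof.
move=> tt [tp [g hg]]; split; first exact: periodic_angle_int tp.
by exists g; exact: landing_ray_int hg.
Qed.

Lemma landing_image (t : R) z : landing t z -> landing (- d%:R * t) (f z).
Proof.
move=> [tp [g [hg g0 gz]]]; split; first exact: periodic_angle_image.
exists (fun r => f (g (expR (ln r / d%:R)))); split.
- exact: ray_image.
- move=> n r r1; rewrite -iterSr; apply: g0.
  have d0 : 0 < d%:R :> R by rewrite ltr0n ltnW.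
  by rewrite -[ltLHS]expR0 ltr_expR divr_gt0// ln_gt0.
- exact: ray_image_cvg.
Qed.

Lemma landing_unique (t t' : R) z z' : t - t' \is a Num.int ->
  landing t z -> landing t' z' -> z = z'.
Proof.
move=> tt [_ [g [hg g0 gz]]] [_ [g' [hg' _ gz']]].
have E := ray_unique d2 hphi tt hg hg' g0.
apply: (@cvgC_unique R _ _ _ g) gz _; apply/cvgC => e e0.
have h := (@cvgC R _ _ _ _ _).1 gz' _ e0.
near=> r; rewrite E; first by near: r; exact: h.
by near: r; exact: nbhs_right_gt.
Unshelve. all: by end_near.
Qed.

Lemma antipoly_rotate (k : int) (z : R[i]) : f (expturn (k%:~R / d%:R) * z) = f z.
Proof.
have d0 : d%:R != 0 :> R by rewrite pnatr_eq0; lia.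
have antipolyE w : f w = conjc w ^+ d + c by [].
rewrite !antipolyE (_ : conjc _ = expturn (- (k%:~R / d%:R)) * conjc z); last first.
  by rewrite -expturnJ; exact: (rmorphM (@conjc R)).
rewrite exprMn expturnMn mulrN mulrCA divff// mulr1.
by rewrite expturn_int ?rpredN ?intr_int// mul1r.
Qed.

Lemma iter_antipoly_rotate (k : int) (z : R[i]) n : (0 < n)%N ->
  iter n f (expturn (k%:~R / d%:R) * z) = iter n f z.
Proof. by case: n => // n _; rewrite !iterSr antipoly_rotate. Qed.

(** At a common point the rotation by k/d disappears under one iterate, and late Boettcher
    coordinates give equal radii and, by periodicity, equal angles. The rays then coincide, the
    rotation fixes the nonzero point [g r] and is trivial, and the landing points are equal. *)
Lemma landing_rays_disjoint (t t' : R) z z' g g' (k : int) r s :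
  periodic_angle d t -> periodic_angle d t' ->
  landing_ray t z g -> landing_ray t' z' g' ->
  z != expturn (k%:~R / d%:R) * z' -> 1 < r -> 1 < s ->
  g r != expturn (k%:~R / d%:R) * g' s.
Proof.
move=> tp tp' [hg g0 gz] [hg' g0' gz'] zz r1 s1; apply/eqP => grs.
have [n hn] := ray_dynamics d2 hg r1; have [n' hn'] := ray_dynamics d2 hg' s1.
(* The successor makes at least one iterate available to absorb the rotation. *)
pose N := (maxn n n').+1.
have [_ pN] : _ /\ _ := hn N (leqW (leq_maxl _ _)).
have [_ pN'] : _ /\ _ := hn' N (leqW (leq_maxr _ _)).
have : (r ^+ (d ^ N))%:C * expturn ((- d%:R) ^+ N * t) =
       (s ^+ (d ^ N))%:C * expturn ((- d%:R) ^+ N * t').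
  by rewrite -pN -pN' grs iter_antipoly_rotate.
have r0 : 0 < r by exact: lt_trans r1.
have s0 : 0 < s by exact: lt_trans s1.
move=> E; have rs : r = s.
  have := congr1 (@cnorm R) E.
  rewrite !cnormM !cnorm_expturn !mulr1 !cnorm_real !ger0_norm ?exprn_ge0 ?ltW//.
  by apply: pexpIrn; rewrite ?nnegrE ?ltW// expn_gt0; lia.
move: E; rewrite -rs => /mulfI.
rewrite fmorph_eq0 expf_neq0 ?gt_eqF// => /(_ isT)/expturn_inj.
rewrite -mulrBr => /(periodic_angle_expand_inj tp tp') tt.
have gg := ray_unique d2 hphi tt hg hg' g0.
have e1 : expturn (k%:~R / d%:R) = 1 :> R[i].
  have gr0 : g r != 0 by apply/eqP; exact: (g0 0%N).
  by apply: (mulIf gr0); rewrite mul1r [in RHS]grs -rs gg.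
move: zz; rewrite e1 mul1r => /eqP; apply.
by apply: (landing_unique tt); split=> //; [exists g|exists g'].
Qed.

Definition bounded_orbit (z : R[i]) := exists B : R, forall n, cnorm (iter n f z) <= B.

Lemma landing_ray_neq_bounded (t : R) z g w (k : int) r : landing_ray t z g ->
  bounded_orbit w -> 1 < r ->
  g r != expturn (k%:~R / d%:R) * w /\ w != expturn (k%:~R / d%:R) * g r.
Proof.
move=> [hg _ _] [B hB] r1; have [n hn] := ray_escape d2 hphi B hg r1.
have := hn n.+1 (leqnSn _); split; apply/eqP => e.
  by have := hB n.+1; rewrite leNgt -(@iter_antipoly_rotate k)// -e (hn n.+1).
by have := hB n.+1; rewrite e iter_antipoly_rotate// leNgt (hn n.+1).
Qed.

Lemma landing_path (t t' s : R) z g g' : landing_ray t z g -> landing_ray t' z g' ->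
  proper_path (fun u => expturn s * joined_rays g g' z u) (t + s) (t' + s).
Proof.
move=> [hg _ gz] [hg' _ gz'].
have asym x h (e : R) : dynamical_ray d f U rho phi x h -> 0 < e ->
    exists r0 : R, forall r, r0 <= r -> 0 < r /\
      cnorm (expturn s * h (1 + r) - r%:C * expturn (x + s)) <= e * r.
  move=> hx e0; have e2 : 0 < e / 2 by rewrite divr_gt0.
  have [r0 hr0] := ray_asymptotic hphi hx e2.
  exists (1 + 2 / e + `|r0|) => r rr.
  have p0 : 0 < 2 / e by rewrite divr_gt0.
  have := ler_norm r0; have := normr_ge0 r0 => n0 nr.
  have r1 : 1 <= r by lra.
  split; first by lra.
  rewrite [x + s]addrC expturnD mulrCA -mulrBr cnormM cnorm_expturn mul1r.
  have -> : h (1 + r) - r%:C * expturn x = (h (1 + r) - (1 + r)%:C * expturn x) + expturn x.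
    by rewrite rmorphD/=; ring.
  apply: le_trans (ler_cnormD _ _) _; rewrite cnorm_expturn.
  have := hr0 (1 + r); have : r0 <= 1 + r by lra.
  move=> h1 /(_ h1) h2; apply: le_trans (lerD h2 (lexx _)) _.
  have : e * (1 + 2 / e) <= e * r by rewrite ler_pM2l//; lra.
  by rewrite mulrDr mulrCA divff ?gt_eqF//; lra.
split.
- have Jc : continuous (joined_rays g g' z).
    by apply: (joined_rays_continuous _ _ gz gz'); [case: hg|case: hg'].
  move=> u; apply: (@cvgCM R _ _ (nbhs_filter u) (fun=> expturn s)
    (joined_rays g g' z) (expturn s) (joined_rays g g' z u)); last exact: Jc.
  exact: (@cvgC_cst R _ _ (nbhs_filter u)).
- move=> e e0; have [r0 hr0] := asym _ _ _ hg e0; exists r0 => r rr.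
  have [rp h] := hr0 r rr.
  by rewrite joined_rays_lt0 ?oppr_lt0// opprK.
- move=> e e0; have [r0 hr0] := asym _ _ _ hg' e0; exists r0 => r rr.
  by have [rp h] := hr0 r rr; rewrite joined_rays_gt0.
Qed.

Lemma joined_landing_rays (t t' : R) z g g' u :
  landing_ray t z g -> landing_ray t' z g' ->
  periodic_angle d t -> periodic_angle d t' ->
  joined_rays g g' z u = z \/ exists (t0 r : R) h,
    [/\ joined_rays g g' z u = h r, 1 < r, periodic_angle d t0 & landing_ray t0 z h].
Proof.
move=> hg hg' tp tp'; have [u0|u0|<-] := ltgtP 0 u.
- right; exists t', (1 + u), g'; split=> //; last by rewrite ltrDl.
  exact: joined_rays_gt0.
- right; exists t, (1 - u), g; split=> //; last by rewrite ltrDl oppr_gt0.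
  exact: joined_rays_lt0.
- by left; rewrite joined_rays0.
Qed.

(** Two rays joined at their landing point form a path, and linked paths meet. The meeting point
    cannot be both landing points, which differ, nor a landing point and a ray point, one bounded
    and the other escaping, nor two ray points. *)
Lemma landing_unlinked (a b a' b' : R) z z' (k : int) :
  bounded_orbit z -> bounded_orbit z' -> z != expturn (k%:~R / d%:R) * z' ->
  landing a z -> landing b z -> landing a' z' -> landing b' z' ->
  ~ (a < a' + k%:~R / d%:R < b /\ b < b' + k%:~R / d%:R < a + 1).
Proof.
move=> Bz Bz' zz [ap [g hg]] [bp [g' hg']] [ap' [h hh]] [bp' [h' hh']] [l1 l2].
have P1 := landing_path 0 hg hg'; rewrite !addr0 in P1.
have P2 := landing_path (k%:~R / d%:R) hh hh'.
have [u [v]] := linked_paths_meet l1 l2 P1 P2; rewrite expturn0 mul1r.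
have [->|[t0 [r [q [-> r1 tp0 hq]]]]] := joined_landing_rays u hg hg' ap bp;
have [->|[t1 [s [q' [-> s1 tp1 hq']]]]] := joined_landing_rays v hh hh' ap' bp'.
- by move/eqP; apply/negP.
- by move/eqP; apply/negP; exact: (landing_ray_neq_bounded k hq' Bz s1).2.
- by move/eqP; apply/negP; exact: (landing_ray_neq_bounded k hq Bz' r1).1.
- by move/eqP; apply/negP; exact: landing_rays_disjoint hq hq' zz r1 s1.
Qed.

(** Multiplication by [-d] makes the shift k/d integral, so equal angles give a - a' integral by
    injectivity on periodic angles. Then k/d is an integer too, and the landing points coincide
    without rotation. *)
Lemma landing_angle_neq (a a' : R) z z' (k : int) :
  z != expturn (k%:~R / d%:R) * z' -> landing a z -> landing a' z' ->
  a != a' + k%:~R / d%:R.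
Proof.
move=> zz la la'; apply/eqP => aa.
have d0 : d%:R != 0 :> R by rewrite pnatr_eq0; lia.
have tt : a - a' \is a Num.int.
  apply: (@periodic_angle_expand_inj a a' 1) la.1 la'.1 _.
  by rewrite aa addrAC subrr add0r expr1 mulNr mulrCA divff// mulr1 rpredN intr_int.
have kd : (k%:~R / d%:R : R) \is a Num.int.
  by apply: int_congr tt; rewrite aa; ring.
by move: zz; rewrite expturn_int// mul1r (landing_unique tt la la') eqxx.
Qed.

End landing.

(** * The theorem *)

Lemma card_nle3_inj (R : realType) (A : set R) : ~ (A #<= `I_3) ->
  exists g : 'I_4 -> R, injective g /\ forall i, A (g i).
Proof.
move=> A3; have : `I_4 #<= A.
  have [/finite_setP[n An]|/finite_setPn/contrapT] := pselect (finite_set A).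
    have [n3|n4] := leqP n 3.
      by case: A3; rewrite (card_le_eql An) card_le_II.
    by rewrite (card_le_eqr An) card_le_II.
  by apply: card_le_trans; exact: card_leT.
move=> /pcard_leP/unsquash g; exists (fun i => g i); split.
  move=> i j /(@inj _ _ _ g); rewrite !inE/= => /(_ (ltn_ord i) (ltn_ord j)).
  exact: val_inj.
by move=> i; apply: (@funS _ _ _ _ g) => /=; exact: ltn_ord.
Qed.

Section orbit.
Variables (T : Type) (f : T -> T) (p : nat) (z : T).
Hypothesis hz : has_period f p z.

Lemma period_iter_mod m : iter m f z = iter (m %% p) f z.
Proof.
have [_ pz _] := hz.
have h k : iter (k * p) f z = z.
  by elim: k => // k IH; rewrite mulSn iterD IH pz.
by rewrite {1}(divn_eq m p) addnC iterD h.
Qed.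

Lemma period_iter_eq j k : iter j f z = iter k f z -> j = k %[mod p].
Proof.
have [p0 pz minp] := hz; rewrite (period_iter_mod j) (period_iter_mod k).
have := ltn_pmod j p0; have := ltn_pmod k p0.
move: (j %% p)%N (k %% p)%N => a b; wlog ab : a b / (a < b)%N => [hw|] bp ap e.
  have [ab|ba|//] := ltngtP a b; first exact: hw.
  by apply/esym/hw.
have := congr1 (iter (p - b) f) e; rewrite -!iterD subnK ?(ltnW bp)// pz.
by move=> /minp; case; lia.
Qed.

End orbit.

(** * Attraction by a periodic critical point *)

Section superattracting.
Variables (R : realType) (d : nat) (c : R[i]).
Hypothesis d2 : (2 <= d)%N.
Notation f := (antipoly d c).

Lemma expn_lipschitz (w : R[i]) (n : nat) : exists2 C : R, 0 <= C &
  forall x, cnorm (x - w) <= 1 -> cnorm (x ^+ n - w ^+ n) <= C * cnorm (x - w).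
Proof.
elim: n => [|n [C C0 IH]].
  by exists 0 => // x _; rewrite !expr0 subrr cnorm0 mul0r.
have w0 := cnorm_ge0 w.
exists ((cnorm w + 1) * C + cnorm w ^+ n) => [|x xw].
  by rewrite addr_ge0// ?exprn_ge0// mulr_ge0// addr_ge0.
have -> : x ^+ n.+1 - w ^+ n.+1 = x * (x ^+ n - w ^+ n) + w ^+ n * (x - w).
  by rewrite !exprS; ring.
apply: le_trans (ler_cnormD _ _) _; rewrite !cnormM cnormX mulrDl -mulrA lerD2r.
apply: ler_pM; rewrite ?cnorm_ge0// ?IH//.
by have := ler_cnormD (x - w) w; rewrite subrK; lra.
Qed.

Lemma antipolyB (x w : R[i]) : cnorm (f x - f w) = cnorm (x ^+ d - w ^+ d).
Proof.
rewrite -[RHS]cnormJ /antipoly opprD addrACA subrr addr0; congr cnorm.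
by rewrite [RHS](rmorphB (@conjc R)) !(rmorphXn (@conjc R)).
Qed.

Lemma iter_antipoly_lipschitz (w : R[i]) (n : nat) : exists C r : R, [/\ 0 <= C, 0 < r &
  forall x, cnorm (x - w) <= r -> cnorm (iter n f x - iter n f w) <= C * cnorm (x - w)].
Proof.
elim: n w => [|n IH] w; first by exists 1, 1; split=> // x _; rewrite mul1r.
have [C [r [C0 r0 hC]]] := IH (f w); have [D D0 hD] := expn_lipschitz w d.
have D1 : 0 < D + 1 by rewrite ltr_wpDl.
exists (C * D), (Num.min 1 (r / (D + 1))); split; first exact: mulr_ge0.
  by rewrite lt_min ltr01 divr_gt0.
move=> x; rewrite le_min ler_pdivlMr// => /andP[x1 xr].
have fx : cnorm (f x - f w) <= D * cnorm (x - w) by rewrite antipolyB hD.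
rewrite !iterSr; apply: le_trans (hC _ _) _.
  apply: le_trans fx _; apply: le_trans _ xr; rewrite mulrC.
  by apply: ler_wpM2l; rewrite ?cnorm_ge0// lerDl.
by rewrite -mulrA; exact: ler_wpM2l.
Qed.

(** Near 0 the first iterate is at least quadratically contracting, |f y - f 0| <= |y|^2, and the
    rest of the period is C-Lipschitz, so C |y|^2 <= |y| on a disk of radius at most 1/(C + 1). *)
Lemma critical_periodic_attracts (p : nat) : (0 < p)%N -> iter p f 0 = 0 ->
  exists2 r : R, 0 < r & forall x, cnorm x <= r -> forall k, cnorm (iter (k * p) f x) <= r.
Proof.
case: p => // n _ n0; have [C [r [C0 r0 hC]]] := iter_antipoly_lipschitz (f 0) n.
have C1 : 0 < C + 1 by rewrite ltr_wpDl.
pose s := Num.min (Num.min 1 r) (C + 1)^-1.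
have s0 : 0 < s by rewrite !lt_min ltr01 r0 invr_gt0.
exists s => // x xs; elim=> [|k IH]; first by rewrite mul0n.
rewrite mulSn iterD; move: (iter _ f x) IH => y {x xs}.
rewrite !le_min -!andbA => /and3P[y1 yr yC].
have yd : cnorm (y ^+ d) <= cnorm y * cnorm y.
  by rewrite cnormX -expr2; apply: ler_wiXn2l; rewrite ?cnorm_ge0.
have fy : cnorm (f y - f 0) <= cnorm y * cnorm y.
  by rewrite antipolyB expr0n; case: d d2 yd => // m _ yd; rewrite subr0.
have fyr : cnorm (f y - f 0) <= r.
  apply: le_trans fy _; apply: le_trans yr.
  by apply: ler_piMl; rewrite ?cnorm_ge0.
have := hC _ fyr; rewrite -!iterSr n0 subr0 => h.
suff : cnorm (iter n.+1 f y) <= cnorm y.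
  move=> h'; rewrite (le_trans h' y1) (le_trans h' yr) (le_trans h' yC)//.
apply: le_trans h _; apply: le_trans (ler_wpM2l C0 fy) _.
rewrite mulrA; apply: ler_piMl; first exact: cnorm_ge0.
have : (C + 1) * cnorm y <= (C + 1) * (C + 1)^-1 by rewrite ler_pM2l.
rewrite divff ?gt_eqF// mulrDl mul1r; have := cnorm_ge0 y; lra.
Qed.

End superattracting.

Lemma circle_lift_seq (R : realType) (A : seq R) : (0 < size A)%N ->
  sorted <%R A -> (forall t, t \in A -> 0 <= t < 1) ->
  exists X, [/\ circle_lift (size A) X,
    forall i, exists m : int, X i - m%:~R \in A
  & forall t (m : int), t \in A -> exists i, t + m%:~R = X i].
Proof.
move=> A0 Asorted A01; set n := size A.
have n0 : 0 < n%:Z by rewrite ltz_nat.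
have nn0 : n%:Z != 0 by rewrite gt_eqF.
pose r (i : int) := absz (i %% n%:Z)%Z.
have rE i : (r i)%:Z = (i %% n%:Z)%Z by rewrite gez0_abs// modz_ge0.
have rn i : (r i < n)%N by rewrite -ltz_nat rE ltz_pmod.
have nthA i : nth 0 A (r i) \in A by rewrite mem_nth.
exists (fun i => nth 0 A (r i) + (i %/ n%:Z)%Z%:~R); split.
- split=> i; last first.
    have -> : r (i + n%:Z) = r i by rewrite /r modzDr.
    by rewrite divzDr ?dvdzz// divzz nn0 intrD addrA.
  have [e|[e iE]] := divz_succ i n0.
    have -> : r (i + 1) = (r i).+1.
      apply/eqP; rewrite -eqz_nat -addn1 PoszD !rE /modz e; apply/eqP; ring.
    have rS : ((r i).+1 < n)%N.
      rewrite -ltz_nat -addn1 PoszD rE.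
      have := ltz_pmod (i + 1) n0; rewrite /modz e.
      by apply: le_lt_trans; rewrite le_eqVlt; apply/orP; left; apply/eqP; ring.
    rewrite e ltrD2r; have := sorted_ltn_nth (@lt_trans _ R) 0 Asorted.
    by move=> /(_ (r i) (r i).+1); apply; rewrite ?inE ?rn ?rS.
  have -> : r (i + 1) = 0%N by rewrite /r iE modzMl.
  rewrite e intrD; have /andP[h _] := A01 _ (mem_nth 0 A0).
  have /andP[_ h'] := A01 _ (nthA i); lra.
- by move=> i; exists (i %/ n%:Z)%Z; rewrite addrK.
- move=> t m tA; exists (m * n%:Z + (index t A)%:Z).
  have it : (index t A < n)%N by rewrite index_mem.
  have -> : r (m * n%:Z + (index t A)%:Z) = index t A.
    by rewrite /r modzMDl modz_small//= ltz_nat it.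
  by rewrite nth_index// divzMDl// divz_small ?addr0// ger0_norm ?ltz_nat ?it// ltW.
Qed.

(** * Lifts of the landing angles along the periodic orbit *)

Section main.
Variables (R : realType) (d : nat) (c : R[i]) (U : set R[i]) (rho : R).
Variable phi : R[i] -> R[i].
Hypothesis d2 : (2 <= d)%N.
Notation f := (antipoly d c).
Hypothesis hphi : bottcher_map d f U rho phi.
Notation landing := (landing d c U rho phi).
Variables (p : nat) (z : R[i]).
Hypotheses (hp : odd p) (hz : has_period f p z).

Lemma periodic_bounded_orbit j : bounded_orbit d c (iter j f z).
Proof.
have [p0 _ _] := hz.
exists (\sum_(k < p) cnorm (iter k f z)) => n.
rewrite -iterD (period_iter_mod hz) (bigD1 (Ordinal (ltn_pmod (n + j) p0)))//=.
by rewrite lerDl sumr_ge0// => k _; exact: cnorm_ge0.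
Qed.

(** A ray landing at a periodic critical point would enter the disk that f^p keeps stable, but each
    of its points escapes. *)
Lemma landing_point_neq0 (t : R) j : landing t (iter j f z) -> iter j f z != 0.
Proof.
move=> [_ [g [hg _ gz]]]; apply/eqP => z0; have [p0 pz _] := hz.
have crit : iter p f 0 = 0 by rewrite -z0 -iterD addnC iterD pz.
have [r r0 hr] := critical_periodic_attracts d2 p0 crit.
have h := (@cvgC R _ _ (at_right_proper_filter 1) _ _).1 gz _ r0.
have [q [q1 qr]] : exists q : R, 1 < q /\ cnorm (g q) <= r.
  have [q [h1 h2]] := filter_ex (filterI h (@nbhs_right_gt R 1)).
  exists q; split=> //; apply: ltW.
  by move: h1; rewrite z0 sub0r cnormN.
have [n hn] := ray_escape d2 hphi r hg q1.
have := hn (n * p)%N (leq_pmulr _ p0); rewrite ltNge => /negP; apply.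
exact: hr.
Qed.

Lemma landing_iter (t : R) j : landing t z -> landing ((- d%:R) ^+ j * t) (iter j f z).
Proof.
move=> tz; elim: j => [|j IH]; first by rewrite expr0 mul1r.
by rewrite exprS -mulrA iterS; exact: landing_image.
Qed.

Lemma orbit_rotate_neq j k (m : int) : j != k %[mod p] ->
  iter j f z != expturn (m%:~R / d%:R) * iter k f z.
Proof.
apply: contra => /eqP e; have := congr1 f e; rewrite antipoly_rotate// -!iterS.
by move=> /(period_iter_eq hz)/eqP; rewrite -[j.+1]addn1 -[k.+1]addn1 eqn_modDr.
Qed.

Lemma orbit_rotate1_neq (t : R) j : landing t (iter j f z) ->
  iter j f z != expturn (1%:~R / d%:R) * iter j f z.
Proof.
move=> /landing_point_neq0 z0; apply/eqP => e.
have : expturn (1%:~R / d%:R) = 1 :> R[i] by apply: (mulIf z0); rewrite [RHS]mul1r [RHS]e.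
have d0 : 0 < d%:R :> R by rewrite ltr0n ltnW.
have : (d%:R : R)^-1 < 1 by rewrite invf_lt1// ltr1n.
have : 0 < (d%:R : R)^-1 by rewrite invr_gt0.
move=> h1 h2 /expturn_eq1; rewrite div1r => hi.
have h3 : (d%:R : R)^-1 = 0 by apply: int_lt1_eq0 hi _; apply/andP; split; lra.
by move: h1; rewrite h3 ltxx.
Qed.

(** The boolean [b] is the parity of the time, and the actual angles are - X when it is true.
    Reflection changes the shift k/d into - k/d, whence the second condition on the rotations. *)
Lemma landing_lifts_unlinked n (b : bool) (X Y : int -> R) w w' :
  circle_lift n X -> bounded_orbit d c w -> bounded_orbit d c w' ->
  (forall i, landing ((-1) ^+ b * X i) w) ->
  (forall i, landing ((-1) ^+ b * Y i) w') ->
  forall k : int, w != expturn (k%:~R / d%:R) * w' ->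
    (b -> w != expturn ((- k)%:~R / d%:R) * w') ->
  unlinked X (fun i => Y i + k%:~R / d%:R).
Proof.
case: b => LX Bw Bw' lX lY k ww wwN.
  have lX' i : landing (- X i) w by rewrite -mulN1r; exact: lX.
  have lY' i : landing (- Y i) w' by rewrite -mulN1r; exact: lY.
  have {}ww := wwN isT.
  split=> [i m|i1 i2 k1 k2 [h1 h2 h3 h4]].
    have := landing_angle_neq d2 hphi ww (lX' i) (lY' m).
    apply: contra => /eqP ->; apply/eqP; rewrite mulrNz mulNr; ring.
  (* Reflection reverses the cyclic order, so the turn now starts at - X i1 - 1 and meets [k2]
     before [k1]. *)
  have lX1 : landing (- X i1 - 1) w.
    apply: landing_int (lX' i1); apply: int_congr (_ : 1 \is a Num.int); last exact: int_num1.
    ring.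
  apply: (landing_unlinked d2 hphi Bw Bw' ww lX1 (lX' i2) (lY' k2) (lY' k1)).
  rewrite mulrNz mulNr; split; apply/andP; split; lra.
have lX' i : landing (X i) w by have := lX i; rewrite expr0 mul1r.
have lY' i : landing (Y i) w' by have := lY i; rewrite expr0 mul1r.
split=> [i m|i1 i2 k1 k2 [h1 h2 h3 h4]].
  exact: (landing_angle_neq d2 hphi ww (lX' i) (lY' m)).
apply: (landing_unlinked d2 hphi Bw Bw' ww (lX' i1) (lX' i2) (lY' k1) (lY' k2)).
by rewrite h1 h2 h3 h4.
Qed.

Lemma landing_sign_expand (X0 X : int -> R) j i : landing (X0 i) z ->
  X i - d%:R ^+ j * X0 i \is a Num.int -> landing ((-1) ^+ j * X i) (iter j f z).
Proof.
move=> l0 h; apply: landing_int (landing_iter j l0).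
have : - ((-1) ^+ j * (X i - d%:R ^+ j * X0 i)) \is a Num.int.
  by rewrite rpredN rpredM// rpredX// rpredN int_num1.
by apply: int_congr; rewrite -[- d%:R]mulN1r exprMn; ring.
Qed.

Lemma landing_hull n (X0 X : int -> R) j : (1 < n)%N -> circle_lift n X ->
  (forall i, landing (X0 i) z) ->
  (forall i, X i - d%:R ^+ j * X0 i \is a Num.int) ->
  exists e, X (e + n%:Z) - X (e + 1) < d%:R^-1.
Proof.
move=> n1 LX l0 XE.
have lX i : landing ((-1) ^+ odd j * X i) (iter j f z).
  by rewrite signr_odd; exact: landing_sign_expand (l0 i) (XE i).
have d0 : 0 < d%:R^-1 :> R by rewrite invr_gt0 ltr0n ltnW.
apply: (unlinked_translate_critical n1 d0 LX).
have Bj := periodic_bounded_orbit j.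
have ne := orbit_rotate1_neq (lX 0).
have := landing_lifts_unlinked LX Bj Bj lX lX ne.
have -> : (fun i => X i + 1%:~R / d%:R) = (fun i => X i + d%:R^-1).
  by apply/funext => i; rewrite div1r.
(* At odd times the rotation by -1/d is needed; a point fixed by it is fixed by the inverse
   rotation. *)
apply=> _; apply: contra ne => /eqP e; apply/eqP.
rewrite [in RHS]e mulrA -expturnD mulrNz mulNr subrr expturn0 mul1r//.
Qed.

Lemma landing_lift n (X0 : int -> R) j : (1 < n)%N -> circle_lift n X0 ->
  (forall i, landing (X0 i) z) ->
  exists X, circle_lift n X /\ forall i, X i - d%:R ^+ j * X0 i \is a Num.int.
Proof.
move=> n1 L0 l0; elim: j => [|j [X [LX XE]]].
  by exists X0; split=> // i; rewrite expr0 mul1r subrr rpred0.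
have [e he] := landing_hull n1 LX l0 XE.
have [Y LY YE] := lift_expand n1 (ltnW d2) LX he.
exists Y; split=> // i.
have h : d%:R * (X i - d%:R ^+ j * X0 i) \is a Num.int.
  by rewrite rpredM// intr_nat.
by apply: int_congr (rpredD (YE i) h); rewrite exprS; ring.
Qed.

Lemma landing_seq_size (A : seq R) : sorted <%R A ->
  (forall t, t \in A -> 0 <= t < 1 /\ landing t z) ->
  (forall t, t \in A -> exists m : int, (- d%:R) ^+ p * t - m%:~R \in A) ->
  (size A <= 3)%N.
Proof.
move=> As AL Ap; have [n1|/leq_trans->//] := ltnP 1 (size A).
have p0 : (0 < p)%N by case: hz.
have [X0 [L0 X0A AX0]] := circle_lift_seq (ltnW n1) As (fun t tA => (AL t tA).1).
have l0 i : landing (X0 i) z.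
  have [m mA] := X0A i; apply: landing_int (AL _ mA).2.
  by apply: int_congr (intr_int R (- m)); rewrite rmorphN/=; ring.
have /choice[Y YP] := fun j => landing_lift j n1 L0 l0.
pose X j := if j is k.+1 then Y j else X0.
have XP j : circle_lift (size A) (X j) /\
    forall i, X j i - d%:R ^+ j * X 0%N i \is a Num.int.
  case: j => [|j]; last exact: YP.
  by split=> // i; rewrite expr0 mul1r subrr rpred0.
have lX j i : landing ((-1) ^+ odd j * X j i) (iter j f z).
  by rewrite signr_odd; exact: landing_sign_expand (l0 i) ((XP j).2 i).
apply: (@lift_dynamics_valence R (size A) d p X) => //.
- by move=> j; exact: (XP j).1.
- by move=> j; exact: (XP j).2.
(* As p is odd, (-d)^p = - d^p: up to an integer, - X p (- i) is the first return of the angle X 0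
   (- i), which belongs to [A] modulo 1. *)
- move=> i; have /intrP[m mE] := (XP p).2 (- i).
  have [m' mA] := X0A (- i); have [m2 mA2] := Ap _ mA.
  have /intrP[m3 m3E] : (d%:R ^+ p * m'%:~R : R) \is a Num.int.
    by rewrite rpredM ?intr_int// rpredX// intr_nat.
  have [k kE] := AX0 _ (m2 - m3 - m) mA2; exists k.
  apply: etrans kE; rewrite !intrB.
  have mE' : m%:~R = X p (- i) - d%:R ^+ p * X0 (- i) := esym mE.
  have pE : (- d%:R) ^+ p = - d%:R ^+ p :> R.
    by rewrite -[- d%:R]mulN1r exprMn -signr_odd hp expr1 mulN1r.
  by rewrite pE mE' -m3E; ring.
- move=> j; exact: landing_hull n1 (XP j).1 l0 (XP j).2.
- move=> j k jk.
  have Bj := periodic_bounded_orbit j; have Bk := periodic_bounded_orbit k.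
  have ne (m : int) := orbit_rotate_neq m jk.
  have [e|e] := eqVneq (odd j) (odd k).
    have lk i : landing ((-1) ^+ odd j * X k i) (iter k f z) by rewrite e.
    by left=> m; exact: (landing_lifts_unlinked (XP j).1 Bj Bk (lX j) lk (ne m) (fun=> ne (- m))).
  have sgn : (-1) ^+ odd j = - (-1) ^+ odd k :> R.
    by move: e; case: (odd j); case: (odd k) => // _; rewrite ?expr0 ?expr1 ?opprK.
  have lk i : landing ((-1) ^+ odd j * - X k (- i)) (iter k f z).
    by rewrite sgn mulrNN.
  by right=> m; exact: (landing_lifts_unlinked (XP j).1 Bj Bk (lX j) lk (ne m) (fun=> ne (- m))).
Qed.

Lemma periodic_angle_common (m : nat) (g : 'I_m -> R) :
  (forall i, periodic_angle d (g i)) ->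
  exists2 K, (0 < K)%N & forall i, (- d%:R) ^+ K * g i - g i \is a Num.int.
Proof.
move=> gp; have /choice[k kP] : forall i, exists k, (0 < k)%N /\
    (- d%:R) ^+ k * g i - g i \is a Num.int.
  by move=> i; have [k k0 kg] := gp i; exists k.
exists (\prod_i k i)%N; first by rewrite prodn_gt0// => i; exact: (kP i).1.
move=> i; rewrite (bigD1 i)//=; move: (\prod_(_ | _) _)%N => l.
elim: l => [|l IH]; first by rewrite muln0 expr0 mul1r subrr rpred0.
rewrite mulnS exprD.
by apply: int_congr (rpredD (expN_int d (k i) IH) (kP i).2); ring.
Qed.

Lemma periodic_rays_at_card : periodic_rays_at d f U rho phi z #<= `I_3.
Proof.
apply: contrapT => /card_nle3_inj[g [gi gS]].
have [p0 pz _] := hz.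
have gl i : landing (g i) z by have [_ gp [_ gz]] := gS i; split.
have [K K0 KP] := periodic_angle_common (fun i => (gl i).1).
(* Every angle of period [K] is a multiple of 1/D, so only D candidates lie in [0, 1). Integrality
   of D t, unlike membership in the four given angles, is preserved by multiplication by [-d]. *)
pose N : int := (- d%:Z) ^+ K - 1; pose D := absz N.
have NE : N%:~R = (- d%:R) ^+ K - 1 :> R.
  by rewrite /N intrB rmorphXn/= mulrNz.
have D0 : (0 < D)%N.
  rewrite absz_gt0; apply/eqP => N0; move: NE; rewrite N0 => /esym/eqP.
  rewrite subr_eq0 => /eqP/(congr1 Num.norm).
  have : 1 < d%:R ^+ K :> R by rewrite exprn_egt1 ?ltr1n// -lt0n.
  by rewrite normrX normrN normr1 normr_nat => d1 e; rewrite e ltxx in d1.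
have D0R : 0 < D%:R :> R by rewrite ltr0n.
have Dint (t : R) : (- d%:R) ^+ K * t - t \is a Num.int -> D%:R * t \is a Num.int.
  rewrite -[X in _ - X]mul1r -mulrBl -NE.
  have -> : D%:R = (`|N|)%R%:~R :> R by rewrite -abszE.
  by case: (ger0P N) => _ //; rewrite mulrNz mulNr rpredN.
pose A := [seq t <- [seq m%:R / D%:R | m <- iota 0 D] | `[< landing t z >]] : seq R.
have memA t : 0 <= t < 1 -> D%:R * t \is a Num.int -> landing t z -> t \in A.
  move=> /andP[t0 t1] /intrP[m mE] lt; rewrite mem_filter; apply/andP; split.
    exact/asboolP.
  have tE : t = m%:~R / D%:R by rewrite -mE mulrC mulKf// gt_eqF.
  have m0 : 0 <= m by rewrite -(ler0z R) -mE mulr_ge0// ltW.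
  have mD : (absz m < D)%N.
    rewrite -ltz_nat gez0_abs// -(ltr_int R) -mE.
    by rewrite -[ltRHS]mulr1 ltr_pM2l.
  apply/mapP; exists (absz m); first by rewrite mem_iota.
  by rewrite tE -[m in LHS]gez0_abs.
have AP t : t \in A -> [/\ 0 <= t < 1, D%:R * t \is a Num.int & landing t z].
  rewrite mem_filter => /andP[/asboolP lt /mapP[m]]; rewrite mem_iota => mD tE.
  have DtE : D%:R * t = m%:R by rewrite tE mulrCA divff ?mulr1// gt_eqF.
  split; [|by rewrite DtE intr_nat|exact: lt].
  by rewrite tE divr_ge0//= ltr_pdivrMr// mul1r ltr_nat.
have : (size A <= 3)%N.
  apply: landing_seq_size.
  - apply: sorted_filter; first exact: lt_trans.
    have h : {homo (fun m : nat => m%:R / D%:R : R) : i j / (i < j)%N >-> i < j}.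
      by move=> i j ij; rewrite ltr_pM2r ?invr_gt0// ltr_nat.
    exact: (homo_sorted h _ (iota_ltn_sorted 0 D)).
  - by move=> t /AP[].
  - move=> t /AP[_ tD lt]; exists (Num.floor ((- d%:R) ^+ p * t)).
    set x := _ * t; apply: memA.
    + have := floor_le x; have := floorD1_gt x; rewrite intrD => h1 h2.
      by apply/andP; split; lra.
    + rewrite mulrBr rpredB//; last by rewrite rpredM ?intr_int// intr_nat.
      by rewrite /x mulrCA; exact: expN_int.
    + have := landing_iter p lt; rewrite pz -/x; apply: landing_int.
      by apply: int_congr (intr_int R (Num.floor x)); rewrite opprB addrC subrK.
rewrite leqNgt => /negP; apply.
have : uniq [seq g i | i <- enum 'I_4] by rewrite map_inj_uniq// enum_uniq.
move=> /uniq_leq_size => /(_ A); rewrite size_map size_enum_ord; apply.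
move=> t /mapP[i _ ->]; apply: memA; last exact: gl.
  by have [] := gS i.
exact: Dint (KP i).
Qed.

End main.

Unset Implicit Arguments.
Set Strict Implicit.
Set Printing Implicit Defensive.

Theorem lemma2p10 (R : realType) (d : nat) (hd : (2 <= d)%N) (c : R[i])
  (U : set R[i]) (rho : R) (phi : R[i] -> R[i])
  (hphi : bottcher_map d (antipoly d c) U rho phi)
  (p : nat) (z : R[i])
  (hp : odd p) (hz : has_period (antipoly d c) p z) :
  periodic_rays_at d (antipoly d c) U rho phi z #<= `I_3.
Proof. exact: (periodic_rays_at_card hd hphi hp hz). Qed.
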